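(* Let $s,t \in T(2,1,1,1)$. Then the following three conditions are equivalent: (1) $F(G(s)) = F(G(t))$; (2) $s \sim_{\mathbb{Z}_p} t$ for all primes $p$; (3) $s_{ijk} = t_{ijk}$ for $(ijk) \in \{(123),(134),(145),(235)\}$, and for each prime $p$ there are $u,v,w,x,y,z \in \mathbb{Z}$ with $p \nmid u$ such that, with $p^k$ the maximal $p$-power dividing the product $s_{134}\, d_3(s)$, $$t_{124} u \equiv s_{124} - s_{123} w + s_{134} v \pmod{p^k},$$ $$t_{135} u \equiv s_{135} + s_{145} w + s_{134} x + s_{235} y \pmod{p^k},$$ $$t_{125} u^2 \equiv s_{125} + s_{135} v + s_{124} x + s_{134} v x + d_3(s) z \pmod{p^k}.$$
   Context: For a group $G$, $F(G)$ denotes the set of isomorphism classes of finite quotients of $G$. For a prime $p$, $\mathbb{Z}_p$ denotes the $p$-adic integers. Let $\mathbb{Z}(5)$ be the set of all integer sequences $t = (t_{ijk} \in \mathbb{Z} \mid 1 \le i<j<k\le 5)$. For $t \in \mathbb{Z}(5)$ let $$G(t) = \langle g_1,\ldots,g_5 \mid [g_j,g_i] = g_{j+1}^{t_{i,j,j+1}} \cdots g_5^{t_{i,j,5}} \text{ for } 1 \le i<j\le 5\rangle$$ (empty products are trivial), where $[a,b] = a^{-1}b^{-1}ab$. Define $d_3(t) = \gcd(t_{123}, t_{145}, t_{235})$ and $$T_0(2,1,1,1) = \{ t \in \mathbb{Z}(5) \mid 0 < t_{123}, t_{134}, t_{145};\ 0 \le t_{124}, t_{125}, t_{135}, t_{235};\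 t_{ijk}=0 \text{ otherwise}\}.$$ For $R = \mathbb{Z}$ or $R = \mathbb{Z}_p$, define a relation on $T_0(2,1,1,1)$ by: $s \sim_R t$ if $s_{ijk} = t_{ijk}$ for $(ijk) \in \{(123),(134),(145),(235)\}$ and there exist $u \in R^*$ and $v,w,x,y,z \in R$ such that $$t_{124} u = s_{124} - s_{123} w + s_{134} v,$$ $$t_{135} u = s_{135} + s_{145} w + s_{134} x + s_{235} y,$$ $$t_{125} u^2 = s_{125} + s_{135} v + s_{124} x + s_{134} v x + d_3(s) z.$$ This is an equivalence relation. $T(2,1,1,1)$ denotes a (fixed) set of representatives of the equivalence classes of $\sim_{\mathbb{Z}}$ on $T_0(2,1,1,1)$. *)

(* Defs.v *)
From HB Require Import structures.
From mathcomp Require Import all_boot all_order all_fingroup all_algebra.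
From mathcomp Require Import generic_quotient.
From mathcomp Require Import boolp classical_sets.

Set Implicit Arguments.
Unset Strict Implicit.
Unset Printing Implicit Defensive.

Import GRing.Theory.

Local Open Scope quotient_scope.

(* A letter [(x, false)] stands for the generator [x], and [(x, true)] for its
   inverse. *)
Definition word (X : Type) := seq (X * bool).

Section Words.
Variable X : Type.
Implicit Types u v : word X.

Definition winv u : word X := rev [seq (a.1, ~~ a.2) | a <- u].

Definition wcomm u v : word X := winv u ++ winv v ++ u ++ v.

Definition wgen (x : X) : word X := [:: (x, false)].

Definition wpow (x : X) (n : int) : word X := nseq `|n|%N (x, (n < 0)%R).

End Words.

Section Presentation.
Variables (X : choiceType) (E : word X -> word X -> Prop).

Inductive pres_cong : word X -> word X -> Prop :=
| pres_refl u : pres_cong u u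
| pres_sym u v : pres_cong u v -> pres_cong v u
| pres_trans u v w : pres_cong u v -> pres_cong v w -> pres_cong u w
| pres_cat u u' v v' :
    pres_cong u u' -> pres_cong v v' -> pres_cong (u ++ v) (u' ++ v')
| pres_cancel x b : pres_cong [:: (x, b); (x, ~~ b)] [::]
| pres_relation u v : E u v -> pres_cong u v.

Definition pres_rel : rel (word X) := fun u v => `[< pres_cong u v >].

Lemma pres_rel_equiv : equiv_class_of pres_rel.
Proof.
split=> [u | u v | v u w].
- by apply/asboolP; exact: pres_refl.
- by apply/asboolP/asboolP; exact: pres_sym.
- by move=> /asboolP uv /asboolP vw; apply/asboolP; exact: pres_trans vw.
Qed.

Canonical pres_equiv := EquivRelPack pres_rel_equiv.

(* The group < X | u = v whenever E u v >. *)
Definition presented := {eq_quot pres_rel}%qT.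

HB.instance Definition _ := Choice.on presented.
HB.instance Definition _ := EqQuotient.on presented.

Lemma pres_piP (u v : word X) :
  pres_cong u v <-> \pi_presented u = \pi_presented v :> presented.
Proof.
split=> [uv | /eqmodP/asboolP//].
by apply/eqmodP/asboolP.
Qed.

Definition pres_mul (a b : presented) : presented :=
  \pi_presented (repr a ++ repr b).
Definition pres_one : presented := \pi_presented [::].
Definition pres_inv (a : presented) : presented := \pi_presented (winv (repr a)).

Lemma winv_cat (u v : word X) : winv (u ++ v) = winv v ++ winv u.
Proof. by rewrite /winv map_cat rev_cat. Qed.

Lemma winvK (u : word X) : winv (winv u) = u.
Proof.
rewrite /winv map_rev revK -map_comp -[RHS]map_id.
by apply: eq_map => -[x b] /=; rewrite negbK.
Qed.

Lemma winv_cons (a : X * bool) (u : word X) :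
  winv (a :: u) = winv u ++ [:: (a.1, ~~ a.2)].
Proof. by rewrite -cat1s winv_cat. Qed.

Lemma pres_mulV (u : word X) : pres_cong (u ++ winv u) [::].
Proof.
elim: u => [|[x b] u IHu]; first exact: pres_refl.
rewrite winv_cons /= -cat_cons -cat1s catA -(catA [:: _]).
apply: pres_trans (pres_cancel x b).
apply: (@pres_cat ([:: (x, b)] ++ (u ++ winv u)) [:: (x, b)]).
  rewrite -[X in pres_cong _ X]cats0.
  exact: pres_cat (pres_refl _) IHu.
exact: pres_refl.
Qed.

Lemma pi_mul (u v : word X) :
  pres_mul (\pi_presented u) (\pi_presented v) = \pi_presented (u ++ v).
Proof. by apply/pres_piP; apply: pres_cat; apply/pres_piP; rewrite reprK. Qed.

Lemma pres_mulA : associative pres_mul.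
Proof.
move=> a b c; rewrite -[a]reprK -[b]reprK -[c]reprK.
rewrite (pi_mul (repr b) (repr c)) (pi_mul (repr a) (repr b)).
by rewrite (pi_mul (repr a) (_ ++ _)) (pi_mul (_ ++ _) (repr c)) catA.
Qed.

Lemma pres_mul1 : left_id pres_one pres_mul.
Proof. by move=> a; rewrite -[a]reprK pi_mul. Qed.

Lemma pres_mul1r : right_id pres_one pres_mul.
Proof. by move=> a; rewrite -[a]reprK pi_mul cats0. Qed.

Lemma pres_mulVl : left_inverse pres_one pres_inv pres_mul.
Proof.
move=> a; rewrite -{2}[a]reprK pi_mul; apply/pres_piP.
by rewrite -{2}[repr a]winvK; exact: pres_mulV.
Qed.

Lemma pres_mulVr : right_inverse pres_one pres_inv pres_mul.
Proof.
move=> a; rewrite -{1}[a]reprK pi_mul; apply/pres_piP; exact: pres_mulV.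
Qed.

HB.instance Definition _ :=
  isGroup.Build presented pres_mulA pres_mul1 pres_mul1r pres_mulVl pres_mulVr.

End Presentation.

(* Sets of isomorphism classes of finite groups are encoded as
   isomorphism-invariant predicates on finite groups.  A finite group is
   isomorphic to a quotient of [G] iff it is the image of a morphism from [G]. *)
Definition finite_quotients (G : groupType) : finGroupType -> Prop :=
  fun Q => exists f : {multiplicative G -> Q}, forall q, exists g, f g = q.

Section Padic.
Variable p : nat.

Definition padic_red (n : nat) (a : 'Z_(p ^ n.+2)) : 'Z_(p ^ n.+1) := inZp a.

Definition padic_coherent : pred (forall n, 'Z_(p ^ n.+1)) :=
  fun a => `[< forall n, padic_red (a n.+1) = a n >].

(* The inverse limit of the rings Z/p^(n+1).  The exponents start at 1 because
   ['Z_1] is Z/2, not the zero ring. *)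
Record padic := Padic {
  padic_proj :> forall n, 'Z_(p ^ n.+1);
  _ : padic_coherent padic_proj }.

HB.instance Definition _ := [isSub for padic_proj].
HB.instance Definition _ := [Choice of padic by <:].

Lemma padicP (a : padic) n : padic_red (a n.+1) = a n.
Proof. by case: a => a /= /asboolP. Qed.

Lemma padic_ext (a b : padic) : (forall n, a n = b n) -> a = b.
Proof. by move=> ab; apply/val_inj/functional_extensionality_dep. Qed.

Lemma padic_dvd n :
  (Zp_trunc (p ^ n.+1)).+2 %| (Zp_trunc (p ^ n.+2)).+2.
Proof.
case: (ltnP 1 p) => [p_gt1 | ].
  by rewrite !Zp_cast ?(ltn_exp2l 0) ?dvdn_exp2l.
by case: p => [|[|//]] _; rewrite ?exp1n ?exp0n.
Qed.

Definition padic_of (f : forall n, 'Z_(p ^ n.+1))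
    (fP : forall n, padic_red (f n.+1) = f n) : padic :=
  Padic (introT (asboolP _) fP).

Local Open Scope ring_scope.

Lemma padic_redD n (x y : 'Z_(p ^ n.+2)) :
  padic_red (x + y) = padic_red x + padic_red y.
Proof. by apply/val_inj; rewrite /= modn_dvdm ?padic_dvd ?modnDm. Qed.

Lemma padic_redM n (x y : 'Z_(p ^ n.+2)) :
  padic_red (x * y) = padic_red x * padic_red y.
Proof. by apply/val_inj; rewrite /= modn_dvdm ?padic_dvd ?modnMm. Qed.

Lemma padic_red0 n : padic_red (0 : 'Z_(p ^ n.+2)) = 0.
Proof. by apply/val_inj; rewrite /= mod0n. Qed.

Lemma padic_red1 n : padic_red (1 : 'Z_(p ^ n.+2)) = 1.
Proof. exact/val_inj. Qed.

Lemma padic_redN n (x : 'Z_(p ^ n.+2)) : padic_red (- x) = - padic_red x.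
Proof.
by apply/(addrI (padic_red x)); rewrite -padic_redD !subrr padic_red0.
Qed.

Fact padic_opp_subproof (a : padic) n : padic_red (- a n.+1) = - a n.
Proof. by rewrite padic_redN padicP. Qed.

Fact padic_add_subproof (a b : padic) n :
  padic_red (a n.+1 + b n.+1) = a n + b n.
Proof. by rewrite padic_redD !padicP. Qed.

Fact padic_mul_subproof (a b : padic) n :
  padic_red (a n.+1 * b n.+1) = a n * b n.
Proof. by rewrite padic_redM !padicP. Qed.

Definition padic_zero := padic_of padic_red0.
Definition padic_one := padic_of padic_red1.
Definition padic_opp a := padic_of (padic_opp_subproof a).
Definition padic_add a b := padic_of (padic_add_subproof a b).
Definition padic_mul a b := padic_of (padic_mul_subproof a b).

Lemma padic_addA : associative padic_add.
Proof. by move=> a b c; apply: padic_ext => n /=; rewrite addrA. Qed.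
Lemma padic_addC : commutative padic_add.
Proof. by move=> a b; apply: padic_ext => n /=; rewrite addrC. Qed.
Lemma padic_add0 : left_id padic_zero padic_add.
Proof. by move=> a; apply: padic_ext => n /=; rewrite add0r. Qed.
Lemma padic_addN : left_inverse padic_zero padic_opp padic_add.
Proof. by move=> a; apply: padic_ext => n /=; rewrite addNr. Qed.

HB.instance Definition _ :=
  GRing.isZmodule.Build padic padic_addA padic_addC padic_add0 padic_addN.

Lemma padic_mulA : associative padic_mul.
Proof. by move=> a b c; apply: padic_ext => n /=; rewrite mulrA. Qed.
Lemma padic_mulC : commutative padic_mul.
Proof. by move=> a b; apply: padic_ext => n /=; rewrite mulrC. Qed.
Lemma padic_mul1 : left_id padic_one padic_mul.
Proof. by move=> a; apply: padic_ext => n /=; rewrite mul1r. Qed.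
Lemma padic_mulDl : left_distributive padic_mul padic_add.
Proof. by move=> a b c; apply: padic_ext => n /=; rewrite mulrDl. Qed.
Lemma padic_oner_neq0 : padic_one != padic_zero.
Proof.
apply/eqP => /(congr1 (fun a : padic => a 0%N)) /= /eqP.
by rewrite oner_eq0.
Qed.

HB.instance Definition _ := GRing.Zmodule_isComNzRing.Build padic
  padic_mulA padic_mulC padic_mul1 padic_mulDl padic_oner_neq0.

Definition padic_unit : pred padic := fun a => `[< exists b, b * a = 1 >].

Definition padic_inv (a : padic) : padic :=
  if pselect (exists b, b * a = 1) is left ex then sval (cid ex) else a.

Lemma padic_mulVr : {in padic_unit, left_inverse 1 padic_inv *%R}.
Proof.
move=> a /asboolP a_unit; rewrite /padic_inv.
by case: pselect => // ex; exact: svalP (cid ex).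
Qed.

Lemma padic_unitPl a b : b * a = 1 -> padic_unit a.
Proof. by move=> ba1; apply/asboolP; exists b. Qed.

Lemma padic_inv_out : {in [predC padic_unit], padic_inv =1 id}.
Proof.
move=> a /negP a_nunit; rewrite /padic_inv.
by case: pselect => // ex; case: a_nunit; apply/asboolP.
Qed.

HB.instance Definition _ := GRing.ComNzRing_hasMulInverse.Build padic
  padic_mulVr padic_unitPl padic_inv_out.

End Padic.

Notation "''Zp[' p ]" := (padic p) (at level 0, format "''Zp[' p ]").

Definition triple5 :=
  {x : nat * nat * nat | [&& 1 <= x.1.1, x.1.1 < x.1.2, x.1.2 < x.2 & x.2 <= 5]}.

Definition Z5 := triple5 -> int.

(* [t_[i, j, k]] is the entry of [t] at (ijk), indexed from 1, and a junk value
   0 unless 1 <= i < j < k <= 5. *)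
Definition Z5_entry (t : Z5) (i j k : nat) : int :=
  if (insub (i, j, k) : option triple5) is Some x then t x else 0%R.

Local Notation "t _[ i , j , k ]" := (Z5_entry t i j k)
  (at level 1, i, j, k at level 99, format "t _[ i ,  j ,  k ]") : ring_scope.

Local Open Scope ring_scope.

(* Generators are indexed by 0, ..., 4: the element [i : 'I_5] is g_(i+1). *)
Definition Gt_relation (t : Z5) (u v : word 'I_5) : Prop :=
  exists i j : 'I_5, [/\ (i < j)%N,
    u = wcomm (wgen j) (wgen i) &
    v = flatten [seq wpow k t _[i.+1, j.+1, k.+1]
                | k : 'I_5 <- enum 'I_5 & (j < k)%N]].

Definition Gt (t : Z5) : groupType := presented (Gt_relation t).

Definition d3 (t : Z5) : int :=
  gcdz (gcdz t _[1, 2, 3] t _[1, 4, 5]) t _[2, 3, 5].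

Definition T0_2111 : set Z5 := [set t |
  [/\ [/\ 0 < t _[1, 2, 3], 0 < t _[1, 3, 4] & 0 < t _[1, 4, 5]],
      [/\ 0 <= t _[1, 2, 4], 0 <= t _[1, 2, 5], 0 <= t _[1, 3, 5]
        & 0 <= t _[2, 3, 5]],
      t _[2, 3, 4] = 0, t _[2, 4, 5] = 0 & t _[3, 4, 5] = 0]].

Definition same_leading (s t : Z5) : Prop :=
  [/\ s _[1, 2, 3] = t _[1, 2, 3], s _[1, 3, 4] = t _[1, 3, 4],
      s _[1, 4, 5] = t _[1, 4, 5] & s _[2, 3, 5] = t _[2, 3, 5]].

Definition sim (R : comUnitRingType) (s t : Z5) : Prop :=
  same_leading s t /\
  exists2 u : R, u \is a GRing.unit & exists v w x y z : R,
   [/\ t _[1, 2, 4]%:~R * u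
         = s _[1, 2, 4]%:~R - s _[1, 2, 3]%:~R * w + s _[1, 3, 4]%:~R * v,
       t _[1, 3, 5]%:~R * u
         = s _[1, 3, 5]%:~R + s _[1, 4, 5]%:~R * w + s _[1, 3, 4]%:~R * x
           + s _[2, 3, 5]%:~R * y
     & t _[1, 2, 5]%:~R * u ^+ 2
         = s _[1, 2, 5]%:~R + s _[1, 3, 5]%:~R * v + s _[1, 2, 4]%:~R * x
           + s _[1, 3, 4]%:~R * v * x + (d3 s)%:~R * z].

Definition representatives (A : Type) (D : set A) (e : A -> A -> Prop)
    (T : set A) : Prop :=
  (T `<=` D)%classic /\ forall a, D a -> exists! b, T b /\ e a b.

Definition padic_local_cond (s t : Z5) (p : nat) : Prop :=
  let q : int := (p ^ logn p `|(s _[1, 3, 4] * d3 s)%R|)%N in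
  exists u v w x y z : int, ~~ (p %| u)%Z /\
   [/\ (t _[1, 2, 4] * u
         = s _[1, 2, 4] - s _[1, 2, 3] * w + s _[1, 3, 4] * v %[mod q])%Z,
       (t _[1, 3, 5] * u
         = s _[1, 3, 5] + s _[1, 4, 5] * w + s _[1, 3, 4] * x
           + s _[2, 3, 5] * y %[mod q])%Z
     & (t _[1, 2, 5] * u ^+ 2
         = s _[1, 2, 5] + s _[1, 3, 5] * v + s _[1, 2, 4] * x
           + s _[1, 3, 4] * v * x + d3 s * z %[mod q])%Z].

(* Main.v *)
(* Write a, b, c, d, e, f, h for t_123, t_124, t_125, t_134, t_135, t_145, t_235,
   and G, G' for the groups of s and t.

   (1) => (2).  For every modulus M the group G acts on (Z/M)^5 by permutations, and
   the image is a finite quotient of G in which the exponents of a normal form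
   g1^k1 ... g5^k5 can be read off modulo M (up to a factor 2).  If G and G' have the
   same finite quotients, this image is generated by elements y1, ..., y5 satisfying
   the relations of G'.  The relations force, modulo a bounded divisor of M,
   y1 = g1^al .., y2 = g2^be .., y3 = g3^ga .., y4 = g4^de .., y5 = g5^ep with
   a al be = a' ga, d al ga = d' de, f al de = f' ep, h be ga = h' ep; moreover al
   and be are prime to p because y1, y2 generate the quotient modulo g3, g4, g5.
   By symmetry the leading entries agree, whence ga = al be, de = al^2 be,
   ep = al^3 be.  Comparing the remaining exponents gives the three equations with
   u = al, modulo arbitrarily large powers of p.

   (3) => (2).  A solution modulo p^k, the p-part of d * d_3, lifts to Z_p with the
   same u: its errors are multiples of d * d_3 over Z_p, and those of the first two
   equations are absorbed by multiples of d_3 added to v and x, which changes the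
   third equation by multiples of d_3 only.

   (2) => (1).  Given a finite quotient Q of G, a solution modulo a multiple M > 1 of
   the order of Q exists by the Chinese remainder theorem.  The same formulas, with
   al = u and be = u^2, turn it into generators of Q satisfying the relations of G'. *)

From HB Require Import structures.
Require Import Defs.
From mathcomp Require Import all_boot all_order all_algebra all_fingroup.
From mathcomp Require Import generic_quotient boolp classical_sets.
From mathcomp Require Import ring zify.

Set Implicit Arguments.
Unset Strict Implicit.
Unset Printing Implicit Defensive.

Import Order.TTheory GRing.Theory Num.Theory.
Local Open Scope ring_scope.

(** * Calculus in a group satisfying the relations *)

Lemma PoszS n : n.+1%:Z = n%:Z + 1.
Proof. by rewrite intS addrC. Qed.

Section IntegerPowers.
Variable G : groupType.
Implicit Types x y z : G.
Local Open Scope group_scope.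

Definition zpow x (n : int) : G :=
  match n with Posz k => x ^+ k | Negz k => x ^- k.+1 end.

Lemma zpow0 x : zpow x 0 = 1. Proof. by []. Qed.
Lemma zpow1 x : zpow x 1 = x. Proof. exact: expg1. Qed.

Lemma zpowS x n : zpow x (n + 1)%R = zpow x n * x.
Proof.
case: n => n; first by rewrite -PoszS /= expgSr.
have -> : (Negz n + 1 = - n%:Z)%R by rewrite NegzE; ring.
case: n => [|n]; first by rewrite oppr0 /= expg1 mulVg.
by rewrite -NegzE /= [in RHS]expgS invgM mulgVK.
Qed.

Lemma zpowB1 x n : zpow x (n - 1)%R = zpow x n * x^-1.
Proof. by rewrite -{2}[n](subrK 1%R) zpowS mulgK. Qed.

Lemma zpowD x m n : zpow x (m + n)%R = zpow x m * zpow x n.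
Proof.
elim/int_ind: n => [|n IHn|n IHn]; first by rewrite addr0 mulg1.
  by rewrite PoszS addrA !zpowS IHn mulgA.
have -> : (- n.+1%:Z = - n%:Z - 1)%R by rewrite PoszS opprD.
by rewrite addrA !zpowB1 IHn mulgA.
Qed.

Lemma zpowN x n : zpow x (- n)%R = (zpow x n)^-1.
Proof. by apply/(mulgI (zpow x n)); rewrite -zpowD subrr mulgV. Qed.

Lemma zpowM x m n : zpow x (m * n)%R = zpow (zpow x m) n.
Proof.
elim/int_ind: n => [|n IHn|n IHn]; first by rewrite mulr0.
  by rewrite PoszS [RHS]zpowS mulrDr mulr1 zpowD IHn.
have -> : (- n.+1%:Z = - n%:Z - 1)%R by rewrite PoszS opprD.
by rewrite [RHS]zpowB1 mulrDr mulrN1 zpowD IHn !zpowN.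
Qed.

Lemma commute_zpow x y n : commute x y -> commute x (zpow y n).
Proof.
move=> xy; case: n => n /=; first exact: commuteX.
by apply/commuteV/commuteX.
Qed.

Lemma commute_zpow2 x y m n : commute x y -> commute (zpow x m) (zpow y n).
Proof. by move=> xy; apply/commute_zpow/commute_sym/commute_zpow/commute_sym. Qed.

Lemma zpow1g n : zpow 1 n = 1.
Proof. by case: n => n /=; rewrite expg1n ?invg1. Qed.

Lemma zpowMg x y n : commute x y -> zpow (x * y) n = zpow x n * zpow y n.
Proof.
move=> xy; elim/int_ind: n => [|n IHn|n IHn]; first by rewrite !zpow0 mulg1.
  rewrite PoszS !zpowS IHn !mulgA; congr (_ * _).
  by rewrite -!mulgA; congr (_ * _); apply/commute_sym/commute_zpow.
have -> : (- n.+1%:Z = - n%:Z - 1)%R by rewrite PoszS opprD.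
rewrite !zpowB1 IHn xy invgM !mulgA; congr (_ * _).
rewrite -!mulgA; congr (_ * _).
by apply/commute_sym/commute_zpow/commute_sym/commuteV/commute_sym.
Qed.

Lemma zpowJ x y n : zpow x n ^ y = zpow (x ^ y) n.
Proof. by case: n => n /=; rewrite ?conjVg conjXg. Qed.

Lemma zpow_swap1 x y z k : x * y = y * x * z -> commute x z ->
  zpow x k * y = y * zpow x k * zpow z k.
Proof.
move=> xy xz; rewrite -mulgA -zpowMg // [LHS]conjgC zpowJ.
by congr (y * zpow _ _); rewrite conjgE xy -mulgA mulKg.
Qed.

(** Here [z] is the commutator of [x] and [y] and commutes with both, so commutators of powers are
    bilinear in the exponents. *)
Lemma zpow_swap x y z k l : x * y = y * x * z -> commute x z -> commute y z ->
  zpow x k * zpow y l = zpow y l * zpow x k * zpow z (k * l)%R.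
Proof.
move=> xy xz yz; have step := zpow_swap1 k xy xz.
have yZ : commute y (zpow z k) by exact: commute_zpow.
have step' : y * zpow x k = zpow x k * y * (zpow z k)^-1.
  rewrite step -(mulgA y) -(mulgA y) mulgK //.
have := zpow_swap1 l step' (commuteV yZ).
move=> ->; rewrite zpowM -!mulgA -zpowMg ?mulVg ?zpow1g ?mulg1 //.
exact/commute_sym/commuteV.
Qed.

Lemma eq_zpow_mod x M m n : x ^+ M = 1 -> (m = n %[mod M])%Z -> zpow x m = zpow x n.
Proof.
move=> xM mn; have xMz k : zpow x (k * M%:Z)%R = 1.
  by rewrite mulrC zpowM /= xM zpow1g.
by rewrite (divz_eq m M) (divz_eq n M) mn !zpowD !xMz.
Qed.

End IntegerPowers.

(* the structure constants (t_123, t_124, t_125, t_134, t_135, t_145, t_235) *)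
Record constants := Constants { ca : nat; cb : nat; cc : nat; cd : nat;
                                ce : nat; cf : nat; ch : nat }.

Section Satisfies.
Variables (P : constants) (G : groupType).
Local Open Scope group_scope.

(** The relations of [G(t)] for [t] in [T0_2111], solved for the products of two generators so that
    no inverse occurs; the entries t_234, t_245, t_345 vanish there. *)
Record satisfies (g1 g2 g3 g4 g5 : G) : Prop := Satisfies {
  rel21 : g2 * g1 = g1 * g2 * (g3 ^+ ca P * g4 ^+ cb P * g5 ^+ cc P);
  rel31 : g3 * g1 = g1 * g3 * (g4 ^+ cd P * g5 ^+ ce P);
  rel41 : g4 * g1 = g1 * g4 * g5 ^+ cf P;
  rel51 : commute g5 g1;
  rel32 : g3 * g2 = g2 * g3 * g5 ^+ ch P;
  rel42 : commute g4 g2;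
  rel52 : commute g5 g2;
  rel43 : commute g4 g3;
  rel53 : commute g5 g3;
  rel54 : commute g5 g4 }.

End Satisfies.

(** * Collection of products into normal form *)

Section Calculus.
Variables (P : constants) (G : groupType) (g1 g2 g3 g4 g5 : G).
Hypothesis gP : satisfies P g1 g2 g3 g4 g5.
Local Notation a := (Posz (ca P)).
Local Notation b := (Posz (cb P)).
Local Notation c := (Posz (cc P)).
Local Notation d := (Posz (cd P)).
Local Notation e := (Posz (ce P)).
Local Notation f := (Posz (cf P)).
Local Notation h := (Posz (ch P)).

(** The part of the normal form without [g1]. In the subgroup generated by [g2], ..., [g5] the only
    possibly nontrivial commutator of generators is that of [g3] and [g2], a power of the central
    [g5]; [g1] acts on this subgroup by conjugation. *)
Definition nf (k2 k3 k4 k5 : int) : G :=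
  (zpow g2 k2 * zpow g3 k3 * zpow g4 k4 * zpow g5 k5)%g.

Lemma nf_eq k2 k3 k4 k5 l2 l3 l4 l5 :
  k2 = l2 -> k3 = l3 -> k4 = l4 -> k5 = l5 -> nf k2 k3 k4 k5 = nf l2 l3 l4 l5.
Proof. by move=> -> -> -> ->. Qed.

Lemma nf1 : nf 0 0 0 0 = 1%g.
Proof. by rewrite /nf !zpow0 !mulg1. Qed.

Lemma nf2 k : nf k 0 0 0 = zpow g2 k.
Proof. by rewrite /nf !zpow0 !mulg1. Qed.

Lemma nf3 k : nf 0 k 0 0 = zpow g3 k.
Proof. by rewrite /nf !zpow0 !mulg1 mul1g. Qed.

Lemma nf4 k : nf 0 0 k 0 = zpow g4 k.
Proof. by rewrite /nf !zpow0 !mulg1 !mul1g. Qed.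

Lemma nf5 k : nf 0 0 0 k = zpow g5 k.
Proof. by rewrite /nf !zpow0 !mul1g. Qed.

Lemma nf_mul k2 k3 k4 k5 l2 l3 l4 l5 :
  (nf k2 k3 k4 k5 * nf l2 l3 l4 l5)%g
    = nf (k2 + l2) (k3 + l3) (k4 + l4) (k5 + l5 + h * k3 * l2).
Proof.
case: gP => _ _ _ _ r32 r42 r52 r43 r53 r54.
rewrite /nf.
have c53 i j : commute (zpow g5 i) (zpow g3 j) by exact: commute_zpow2.
have c52 i j : commute (zpow g5 i) (zpow g2 j) by exact: commute_zpow2.
have c54 i j : commute (zpow g5 i) (zpow g4 j) by exact: commute_zpow2.
have c42 i j : commute (zpow g4 i) (zpow g2 j) by exact: commute_zpow2.
have c43 i j : commute (zpow g4 i) (zpow g3 j) by exact: commute_zpow2.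
have s32 i j : (zpow g3 i * zpow g2 j
    = zpow g2 j * zpow g3 i * zpow g5 (h * i * j))%g.
  rewrite (zpow_swap i j r32); first last.
  - exact/commuteX/commute_sym.
  - exact/commuteX/commute_sym.
  by congr (_ * _)%g; rewrite -mulrA [RHS]zpowM.
rewrite !zpowD !mulgA.
rewrite -(mulgA _ (zpow g5 k5) (zpow g2 l2)) c52 !mulgA.
rewrite -(mulgA _ (zpow g4 k4) (zpow g2 l2)) c42 !mulgA.
rewrite -(mulgA _ (zpow g3 k3) (zpow g2 l2)) s32 !mulgA.
rewrite -(mulgA _ (zpow g5 k5) (zpow g3 l3)) c53 !mulgA.
rewrite -(mulgA _ (zpow g4 k4) (zpow g3 l3)) c43 !mulgA.
rewrite -(mulgA _ (zpow g5 (h * k3 * l2)) (zpow g3 l3)) c53 !mulgA.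
rewrite -(mulgA _ (zpow g5 (h * k3 * l2)) (zpow g4 k4)) c54 !mulgA.
rewrite -(mulgA _ (zpow g5 k5) (zpow g4 l4)) c54 !mulgA.
rewrite -(mulgA _ (zpow g5 (h * k3 * l2)) (zpow g4 l4)) c54 -!mulgA.
congr (_ * (_ * (_ * (_ * (_ * (_ * _))))))%g.
by rewrite -!zpowD; congr (zpow g5 _); ring.
Qed.

Lemma nf_zpow0 i j k n : zpow (nf 0 i j k) n = nf 0 (i * n) (j * n) (k * n).
Proof.
elim/int_ind: n => [|n IHn|n IHn]; first by rewrite !mulr0 nf1.
  rewrite PoszS zpowS IHn nf_mul.
  by apply: nf_eq; ring.
have -> : - n.+1%:Z = - n%:Z - 1 by rewrite PoszS opprD.
apply: (mulIg (nf 0 i j k)); rewrite zpowB1 mulgVK IHn nf_mul.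
by apply: nf_eq; ring.
Qed.

(** The binomial coefficient counts the pairs of factors in which the [g3] part of the earlier one
    has to pass the [g2] of the later one. *)
Lemma nf_exp1 i j k n :
  (nf 1 i j k ^+ n)%g
    = nf n%:Z (i * n%:Z) (j * n%:Z) (k * n%:Z + h * i * 'C(n, 2)%:Z).
Proof.
elim: n => [|n IHn]; first by rewrite expg0 !mulr0 addr0 nf1.
rewrite expgSr IHn nf_mul binS bin1 !PoszD PoszS.
by apply: nf_eq; ring.
Qed.

Lemma conj_g5 : (g5 ^ g1)%g = nf 0 0 0 1.
Proof. by rewrite nf5 zpow1 conjgE (rel51 gP) mulKg. Qed.

Lemma conj_g4 : (g4 ^ g1)%g = nf 0 0 1 f.
Proof.
by rewrite conjgE (rel41 gP) -mulgA mulKg /nf !zpow0 zpow1 !mul1g.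
Qed.

Lemma conj_g3 : (g3 ^ g1)%g = nf 0 1 d e.
Proof.
by rewrite conjgE (rel31 gP) -mulgA mulKg /nf !zpow0 zpow1 !mul1g -mulgA.
Qed.

Lemma conj_g2 : (g2 ^ g1)%g = nf 1 a b c.
Proof. by rewrite conjgE (rel21 gP) -mulgA mulKg /nf zpow1 !mulgA. Qed.

(* Exponents of [g4] and [g5] in [g2 ^ (g1 ^+ n)]. *)
Definition conj_g2_exp4 (n : nat) : int := b * n%:Z + a * d * 'C(n, 2)%:Z.
Definition conj_g2_exp5 (n : nat) : int :=
  c * n%:Z + (a * e + b * f) * 'C(n, 2)%:Z + a * d * f * 'C(n, 3)%:Z.

(** The exponent [k2] is natural because the power of [g2 ^ g1] contributes the binomial coefficient
    of [nf_exp1]. *)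
Lemma nf_conj1 (k2 : nat) k3 k4 k5 : (nf k2%:Z k3 k4 k5 ^ g1)%g =
  nf k2%:Z (k3 + a * k2%:Z) (k4 + d * k3 + b * k2%:Z)
     (k5 + c * k2%:Z + h * a * 'C(k2, 2)%:Z + e * k3 + f * k4).
Proof.
rewrite {1}/nf !conjMg !zpowJ conj_g5 conj_g4 conj_g3 conj_g2 !nf_zpow0.
rewrite [zpow _ k2]nf_exp1 !nf_mul.
by apply: nf_eq; ring.
Qed.

(** Conjugation by [g1] is unipotent along the chain [g2], [g3], [g4], [g5], so its [n]-th iterate
    is polynomial of degree at most three in [n]; in terms of binomial coefficients the induction
    step is Pascal's rule. *)
Lemma nf_conjX (n k2 : nat) k3 k4 k5 : (nf k2%:Z k3 k4 k5 ^ (g1 ^+ n))%g =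
  nf k2%:Z (k3 + a * n%:Z * k2%:Z) (k4 + d * n%:Z * k3 + conj_g2_exp4 n * k2%:Z)
     (k5 + conj_g2_exp5 n * k2%:Z + h * a * n%:Z * 'C(k2, 2)%:Z
        + (e * n%:Z + d * f * 'C(n, 2)%:Z) * k3 + f * n%:Z * k4).
Proof.
rewrite /conj_g2_exp4 /conj_g2_exp5; elim: n => [|n IHn].
  by rewrite expg0 conjg1; apply: nf_eq; rewrite ?bin0n /=; ring.
rewrite expgSr conjgM IHn nf_conj1 !binS bin1 !PoszD PoszS.
by apply: nf_eq; ring.
Qed.

Lemma nf_swap k2 k3 k4 k5 l2 l3 l4 l5 : (nf k2 k3 k4 k5 * nf l2 l3 l4 l5)%g
  = (nf l2 l3 l4 l5 * nf k2 k3 k4 (k5 + h * (k3 * l2 - l3 * k2)))%g.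
Proof. by rewrite !nf_mul; apply: nf_eq; ring. Qed.

(** This formula turns a relation between normal forms into equations between exponents; both the
    construction of generators from solutions and the converse compute with it. *)
Lemma nf_swap_g1 (n k2 : nat) k3 k4 k5 l2 l3 l4 l5 :
  (nf k2%:Z k3 k4 k5 * (g1 ^+ n * nf l2 l3 l4 l5))%g
  = (g1 ^+ n * nf l2 l3 l4 l5 *
     nf k2%:Z (k3 + a * n%:Z * k2%:Z) (k4 + d * n%:Z * k3 + conj_g2_exp4 n * k2%:Z)
     (k5 + conj_g2_exp5 n * k2%:Z + h * a * n%:Z * 'C(k2, 2)%:Z
        + (e * n%:Z + d * f * 'C(n, 2)%:Z) * k3 + f * n%:Z * k4
        + h * ((k3 + a * n%:Z * k2%:Z) * l2 - l3 * k2%:Z)))%g.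
Proof. by rewrite mulgA [(nf _ _ _ _ * _)%g]conjgC nf_conjX -mulgA nf_swap mulgA. Qed.

End Calculus.

(** * Solutions of the equations yield generators *)

(** By von Dyck's theorem these are the finite quotients of the group with constants [P]; the
    presented group itself reappears only in [finite_quotients_Gt]. *)
Definition is_quotient (P : constants) (Q : finGroupType) : Prop :=
  exists g1 g2 g3 g4 g5 : Q, satisfies P g1 g2 g3 g4 g5 /\
    <<[set g1; g2; g3; g4; g5]>>%g = [set: Q].

(** Right multiplication by a generator preserves the normal form. In a finite group every element
    of the generated subgroup is a product of generators without inverses, which keeps the exponents
    of [g1] and [g2] natural. *)
Lemma gen_normal_form (P : constants) (Q : finGroupType) (g1 g2 g3 g4 g5 x : Q) :
  satisfies P g1 g2 g3 g4 g5 -> x \in <<[set g1; g2; g3; g4; g5]>>%g ->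
  exists (k1 k2 : nat) (k3 k4 k5 : int),
    x = (g1 ^+ k1 * nf g2 g3 g4 g5 k2%:Z k3 k4 k5)%g.
Proof.
move=> gP /gen_prodgP[n [c cg ->]] {x}.
elim: n c cg => [|n IHn] c cg.
  by exists 0, 0, 0, 0, 0; rewrite big_ord0 nf1 mulg1.
rewrite big_ord_recr /=.
have [i|k1 [k2 [k3 [k4 [k5 ->]]]]] := IHn (fun i => c (widen_ord (leqnSn n) i)).
  exact: cg.
have nfM := nf_mul gP; have := cg ord_max; rewrite !inE.
case/orP => [|/eqP->]; last first.
  by exists k1, k2, k3, k4; eexists; rewrite -mulgA -[X in (_ * (_ * X))%g]zpow1
    -(nf5 g2 g3 g4) nfM !addr0; reflexivity.
case/orP => [|/eqP->]; last first.
  by exists k1, k2, k3; do 2!eexists; rewrite -mulgA -[X in (_ * (_ * X))%g]zpow1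
    -(nf4 g2 g3 g4 g5) nfM !addr0; reflexivity.
case/orP => [|/eqP->]; last first.
  by exists k1, k2; do 3!eexists; rewrite -mulgA -[X in (_ * (_ * X))%g]zpow1
    -(nf3 g2 g3 g4 g5) nfM !addr0; reflexivity.
case/orP => /eqP->; last first.
  by exists k1, k2.+1; do 3!eexists; rewrite -mulgA -[X in (_ * (_ * X))%g]zpow1
    -(nf2 g2 g3 g4 g5) nfM PoszS; reflexivity.
exists k1.+1, k2; do 3!eexists.
rewrite expgSr -mulgA -[RHS]mulgA; congr (_ * _)%g.
by rewrite conjgC (nf_conj1 gP); reflexivity.
Qed.

(* The three equations defining [~_R], with the common leading entries read off
   the first argument. *)
Definition solvable_in (R : comUnitRingType) (P P' : constants) : Prop :=
  exists2 u : R, u \is a GRing.unit & exists v w x y z : R,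
   [/\ (cb P')%:R * u = (cb P)%:R - (ca P)%:R * w + (cd P)%:R * v,
       (ce P')%:R * u
         = (ce P)%:R + (cf P)%:R * w + (cd P)%:R * x + (ch P)%:R * y
     & (cc P')%:R * u ^+ 2
         = (cc P)%:R + (ce P)%:R * v + (cb P)%:R * x + (cd P)%:R * v * x
           + (gcdn (gcdn (ca P) (cf P)) (ch P))%:R * z].

Definition same_lead (P P' : constants) : Prop :=
  [/\ ca P' = ca P, cd P' = cd P, cf P' = cf P & ch P' = ch P].

Lemma Bezout3 (a f h : nat) :
  exists i j k : int, (gcdn (gcdn a f) h)%:Z = a%:Z * i + f%:Z * j + h%:Z * k.
Proof.
have [i [j ij]] := Bezoutz a f; have [k [l kl]] := Bezoutz (gcdn a f) h.
exists (k * i), (k * j), l.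
move: kl ij; rewrite /gcdz !absz_nat => <- ij; rewrite -[(gcdn a f)%:Z]ij; ring.
Qed.

Lemma intZp_eq0 (M : nat) (m : int) : (1 < M)%N ->
  (m%:~R == 0 :> 'Z_M) = (M%:Z %| m)%Z.
Proof.
move=> M_gt1; have natZp n : (n%:R == 0 :> 'Z_M) = (M %| n)%N.
  by rewrite Zp_nat -val_eqE /= Zp_cast.
case: m => n; first by rewrite -pmulrn natZp.
by rewrite NegzE mulrNz oppr_eq0 dvdzE abszN -pmulrn natZp.
Qed.

Lemma eq_intZp (M : nat) (m n : int) : (1 < M)%N ->
  (m%:~R == n%:~R :> 'Z_M) = (M%:Z %| m - n)%Z.
Proof. by move=> M_gt1; rewrite -subr_eq0 -intrB intZp_eq0. Qed.

Section Transport.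
Variables (Q : finGroupType) (M : nat).
Hypotheses (M_gt1 : (1 < M)%N) (QM : forall x : Q, (x ^+ M = 1)%g).
Local Notation R := 'Z_M.

Definition lift_exp (x : R) : int := Posz (val x).

Lemma lift_expK x : (lift_exp x)%:~R = x.
Proof. exact: natr_Zp. Qed.

Lemma eq_zpow_Zp (x : Q) (m n : int) : m%:~R = n%:~R :> R -> zpow x m = zpow x n.
Proof.
move=> mn; apply: (eq_zpow_mod (QM x)); apply/eqP.
by rewrite eqz_mod_dvd -eq_intZp ?mn.
Qed.

Lemma nf_eq_Zp (g2 g3 g4 g5 : Q) (k2 k3 k4 k5 l2 l3 l4 l5 : int) :
  k2%:~R = l2%:~R :> R -> k3%:~R = l3%:~R :> R -> k4%:~R = l4%:~R :> R ->
  k5%:~R = l5%:~R :> R -> nf g2 g3 g4 g5 k2 k3 k4 k5 = nf g2 g3 g4 g5 l2 l3 l4 l5.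
Proof.
move=> e2 e3 e4 e5; rewrite /nf.
by rewrite (eq_zpow_Zp _ e2) (eq_zpow_Zp _ e3) (eq_zpow_Zp _ e4) (eq_zpow_Zp _ e5).
Qed.

Lemma zpow_in (x : Q) n (H : {group Q}) : x \in H -> zpow x n \in H.
Proof. by move=> xH; case: n => n /=; rewrite ?groupV groupX. Qed.

Lemma zpow_unit_in (x : Q) (u : R) (H : {group Q}) :
  u \is a GRing.unit -> zpow x (lift_exp u) \in H -> x \in H.
Proof.
move=> uU xu; have -> : x = zpow (zpow x (lift_exp u)) (lift_exp u^-1).
  rewrite -[LHS]zpow1 -zpowM; apply: eq_zpow_Zp.
  by rewrite intrM !lift_expK divrr.
exact: zpow_in.
Qed.

Variables (P P' : constants) (g1 g2 g3 g4 g5 : Q).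
Hypothesis gP : satisfies P g1 g2 g3 g4 g5.
Hypothesis gQ : <<[set g1; g2; g3; g4; g5]>>%g = [set: Q].
Hypothesis PP' : same_lead P P'.

(** The new generators are triangular in the old ones, with diagonal exponents [u], [u ^+ 2], ...,
    [u ^+ 5]. Exponents matter only modulo [M], so they may be computed in the ring ['Z_M]. *)
Lemma is_quotient_transport : solvable_in R P P' -> is_quotient P' Q.
Proof.
case=> u uU [v [w [x [y [z [E4 E5 E]]]]]].
case: PP' => Ea Ed Ef Eh.
(* The term with [z] is split into multiples of [ca P], [cf P] and [ch P], which are absorbed by the
   exponents [s], [q] and [r3] respectively. *)
have [i [j [k ijk]]] := Bezout3 (ca P) (cf P) (ch P).
have {ijk} ijk : (gcdn (gcdn (ca P) (cf P)) (ch P))%:R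
    = (ca P)%:R * i%:~R + (cf P)%:R * j%:~R + (ch P)%:R * k%:~R :> R.
  have := congr1 (fun n : int => n%:~R : R) ijk.
  by rewrite /= -pmulrn => ->; ring.
rewrite {}ijk in E.
have named (A : Type) (t : A) : {t' | t' = t} by exists t.
have [al alE] : {al : nat | al%:R = u} by exists (val u); exact: natr_Zp.
have [be beE] : {be : nat | be%:R = u ^+ 2}.
  by exists (val (u ^+ 2)); exact: natr_Zp.
have [k2 k2E] : {k2 : R | 'C(al, 2)%:R = k2 * u}.
  by exists ('C(al, 2)%:R / u); rewrite divrK.
have [k3 k3E] : {k3 : R | 'C(al, 3)%:R = k3 * u}.
  by exists ('C(al, 3)%:R / u); rewrite divrK.
have [kb kbE] : {kb : R | 'C(be, 2)%:R = kb * u ^+ 2}.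
  by exists ('C(be, 2)%:R / u ^+ 2); rewrite divrK ?unitrX.
have {}E4 : (cb P)%:R = (cb P')%:R * u + (ca P)%:R * w - (cd P)%:R * v.
  by rewrite E4; ring.
have {}E5 : (ce P)%:R
    = (ce P')%:R * u - (cf P)%:R * w - (cd P)%:R * x - (ch P)%:R * y.
  by rewrite E5; ring.
have {}E : (cc P)%:R = (cc P')%:R * u ^+ 2 - ((ce P)%:R * v + (cb P)%:R * x
   + (cd P)%:R * v * x + ((ca P)%:R * i%:~R + (cf P)%:R * j%:~R
   + (ch P)%:R * k%:~R) * z) by rewrite E; ring.
(* These exponents solve the new relations: [m] comes from the [g4] exponents of [rel21], [o] from
   the [g5] exponents of [rel31], and [q], [s], [r3] from the [g5] exponents of [rel21]. *)
have [q qE] := named R (u ^+ 2 * (z * j%:~R - ((cb P)%:R * k2 + (cd P)%:R * v * k2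
   - 2%:R * k2 * ((cb P)%:R + (cd P)%:R * v)))).
have [s sE] := named R (u ^+ 3 * ((ce P)%:R * k2 + (cd P)%:R * (cf P)%:R * k3
   + (ch P)%:R * kb + (ch P)%:R * y * u - w * x + 2%:R * (cf P)%:R * k2 * w
   - z * i%:~R)).
have [r3 r3E] := named R (u * (y * v - z * k%:~R)).
have [m mE] := named R ((w + (cd P)%:R * k2) * u ^+ 3).
have [o oE] := named R ((2%:R * (cf P)%:R * k2 - x) * u ^+ 4).
pose l := lift_exp.
have [y1 y1E] := named Q (g1 ^+ al * nf g2 g3 g4 g5 (l (u * y)%R) (l r3) 0 0)%g.
have [y2 y2E] := named Q (nf g2 g3 g4 g5 be%:Z (l (v * u ^+ 2)) (l q) 0).
have [y3 y3E] := named Q (nf g2 g3 g4 g5 0%N%:Z (l (u ^+ 3)) (l m) (l s)).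
have [y4 y4E] := named Q (nf g2 g3 g4 g5 0%N%:Z 0 (l (u ^+ 4)) (l o)).
have [y5 y5E] := named Q (nf g2 g3 g4 g5 0%N%:Z 0 0 (l (u ^+ 5))).
have nfM := nf_mul gP.
exists y1, y2, y3, y4, y5; split.
  have pw i1 i2 i3 n : (nf g2 g3 g4 g5 0%N%:Z i1 i2 i3 ^+ n)%g
      = nf g2 g3 g4 g5 0 (i1 * n%:Z) (i2 * n%:Z) (i3 * n%:Z).
    by rewrite -(nf_zpow0 gP).
  have simp := (intrD, intrM, intrB, mulrNz, lift_expK, alE, beE, k2E, k3E, kbE).
  have sw (i2 : nat) i3 i4 i5 :=
    nf_swap_g1 gP al i2 i3 i4 i5 (l (u * y)%R) (l r3) 0 0.
  rewrite -y1E in sw.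
  split; rewrite /commute.
  - rewrite {1}y2E sw -mulgA y2E y3E y4E y5E !pw !nfM; congr (_ * _)%g.
    apply: nf_eq_Zp; rewrite /conj_g2_exp4 /conj_g2_exp5 !simp -!pmulrn ?simp ?Ea.
    + by ring.
    + by ring.
    + by rewrite E4 mE; ring.
    + by rewrite E sE oE qE r3E E5 E4; ring.
  - rewrite {1}y3E sw -mulgA y3E y4E y5E !pw !nfM; congr (_ * _)%g.
    apply: nf_eq_Zp; rewrite /conj_g2_exp4 /conj_g2_exp5 !simp -!pmulrn ?simp ?Ed.
    + by ring.
    + by ring.
    + by ring.
    + by rewrite sE oE r3E mE E5; ring.
  - rewrite {1}y4E sw -mulgA y4E y5E !pw !nfM; congr (_ * _)%g.
    by apply: nf_eq_Zp; rewrite /conj_g2_exp4 /conj_g2_exp5 !simp -!pmulrn ?simp ?Ef; ring.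
  - rewrite y5E sw; congr (_ * _)%g.
    by apply: nf_eq_Zp; rewrite /conj_g2_exp4 /conj_g2_exp5 ?simp -!pmulrn ?simp; ring.
  - rewrite y2E y3E y5E !pw !nfM.
    by apply: nf_eq_Zp; rewrite !simp -!pmulrn ?simp ?Eh; ring.
  - by rewrite y4E y2E !nfM; apply: nf_eq; ring.
  - by rewrite y5E y2E !nfM; apply: nf_eq; ring.
  - by rewrite y4E y3E !nfM; apply: nf_eq; ring.
  - by rewrite y5E y3E !nfM; apply: nf_eq; ring.
  - by rewrite y5E y4E !nfM; apply: nf_eq; ring.
have [H HE] := named {group Q} <<[set y1; y2; y3; y4; y5]>>%G.
have yH t : t \in [set y1; y2; y3; y4; y5] -> t \in H.
  by rewrite HE; exact: mem_gen.
have H1 : y1 \in H by rewrite yH // !inE eqxx.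
have H2 : y2 \in H by rewrite yH // !inE eqxx !orbT.
have H3 : y3 \in H by rewrite yH // !inE eqxx !orbT.
have H4 : y4 \in H by rewrite yH // !inE eqxx !orbT.
have H5 : y5 \in H by rewrite yH // !inE eqxx !orbT.
(* Since [u] is a unit, the old generators are recovered from the last to the first. *)
have G5 : g5 \in H.
  by apply: (@zpow_unit_in _ (u ^+ 5)); rewrite ?unitrX // -(nf5 g2 g3 g4) -y5E.
have G4 : g4 \in H.
  apply: (@zpow_unit_in _ (u ^+ 4)); rewrite ?unitrX //.
  by move: H4; rewrite y4E /nf !zpow0 !mul1g groupMr //; exact: zpow_in.
have G3 : g3 \in H.
  apply: (@zpow_unit_in _ (u ^+ 3)); rewrite ?unitrX //.
  by move: H3; rewrite y3E /nf !zpow0 !mul1g !groupMr //; exact: zpow_in.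
have G2 : g2 \in H.
  apply: (@zpow_unit_in _ (u ^+ 2)); rewrite ?unitrX // /lift_exp.
  rewrite -(@eq_zpow_Zp _ be%:Z) ?lift_expK //.
  by move: H2; rewrite y2E /nf !groupMr //; exact: zpow_in.
have G1 : g1 \in H.
  apply: (@zpow_unit_in _ u) => //.
  rewrite -(@eq_zpow_Zp _ al%:Z) ?lift_expK //.
  by move: H1; rewrite y1E /nf groupMr // !groupM //; exact: zpow_in.
have -> : <<[set y1; y2; y3; y4; y5]>>%g = H by rewrite HE.
apply/eqP; rewrite finset.eqEsubset finset.subsetT /= -gQ gen_subG.
apply/fintype.subsetP => t.
by rewrite !inE => /orP[/orP[/orP[/orP[]|]|]|] /eqP->.
Qed.

End Transport.

(** * Morphisms from the presented groups to finite groups *)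

Section UniversalProperty.
Variables (X : choiceType) (E : word X -> word X -> Prop) (Q : finGroupType).
Local Open Scope group_scope.

Definition eval_letter (y : X -> Q) (a : X * bool) : Q :=
  if a.2 then (y a.1)^-1 else y a.1.

Definition eval_word (y : X -> Q) (w : word X) : Q :=
  foldr (fun a q => eval_letter y a * q) 1 w.

Lemma eval_cat y u v : eval_word y (u ++ v) = eval_word y u * eval_word y v.
Proof. by elim: u => [|a u IHu] /=; rewrite ?mul1g // IHu mulgA. Qed.

Lemma eval_winv y u : eval_word y (winv u) = (eval_word y u)^-1.
Proof.
elim: u => [|[x b] u IHu]; first by rewrite invg1.
by rewrite winv_cons eval_cat IHu /= mulg1 invgM; case: b; rewrite //= invgK.
Qed.

Lemma eval_wgen y x : eval_word y (wgen x) = y x.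
Proof. exact: mulg1. Qed.

Lemma eval_wcomm y u v :
  eval_word y (wcomm u v) = [~ eval_word y u, eval_word y v].
Proof. by rewrite /wcomm !eval_cat !eval_winv commgEl conjgE !mulgA. Qed.

Lemma eval_wpow y x (n : nat) : eval_word y (wpow x n) = y x ^+ n.
Proof. by rewrite /wpow /=; elim: n => //= n ->; rewrite expgS. Qed.

Section Lift.
Variable y : X -> Q.
Hypothesis yE : forall u v, E u v -> eval_word y u = eval_word y v.

Lemma eval_cong u v : pres_cong E u v -> eval_word y u = eval_word y v.
Proof.
elim=> {u v} // [u v w _ -> _ -> // | u u' v v' _ uu _ vv | x b].
  by rewrite !eval_cat uu vv.
by case: b; rewrite /= mulg1 ?mulVg ?mulgV.
Qed.

Definition lift_word (g : presented E) : Q := eval_word y (repr g).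

Lemma lift_word_pi w : lift_word (\pi_(presented E)%qT w) = eval_word y w.
Proof. by apply/eval_cong/pres_piP; rewrite reprK. Qed.

Lemma lift_wordM : {morph lift_word : g g' / g * g'}.
Proof. by move=> g g'; rewrite lift_word_pi eval_cat. Qed.

HB.instance Definition _ := isMultiplicative.Build _ _ lift_word lift_wordM.

Lemma presented_lift : exists f : {multiplicative presented E -> Q},
  forall w, f (\pi_(presented E)%qT w) = eval_word y w.
Proof. by exists lift_word; exact: lift_word_pi. Qed.

End Lift.

Lemma morphism_eval (f : {multiplicative presented E -> Q}) w :
  f (\pi_(presented E)%qT w)
    = eval_word (fun x => f (\pi_(presented E)%qT (wgen x))) w.
Proof.
have f1 : f 1 = 1 by apply: (mulgI (f 1)); rewrite -gmulfM !mulg1.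
elim: w => [|[x b] w IHw] /=; first exact: f1.
rewrite -IHw -cat1s -Defs.pi_mul [LHS]gmulfM; congr (_ * _).
case: b => //=; apply: (mulIg (f (\pi_(presented E)%qT (wgen x)))).
rewrite mulVg -gmulfM -f1; congr (f _).
by rewrite [LHS]Defs.pi_mul; apply/pres_piP; exact: (pres_cancel E x true).
Qed.

(** Von Dyck's theorem: morphisms from the presented group correspond to assignments to the
    generators that respect the relations, and the image consists of the values of words. *)
Lemma finite_quotients_presented :
  finite_quotients (presented E) Q <->
  exists2 y : X -> Q, (forall u v, E u v -> eval_word y u = eval_word y v) &
    forall q, exists w, q = eval_word y w.
Proof.
split=> [[f f_surj] | [y yE y_surj]].
  exists (fun x => f (\pi_(presented E)%qT (wgen x))).
    by move=> u v Euv; rewrite -!morphism_eval; congr (f _);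
       apply/pres_piP/pres_relation.
  move=> q; have [g <-] := f_surj q.
  by exists (repr g); rewrite -morphism_eval reprK.
have [f fE] := presented_lift yE; exists f => q.
by have [w ->] := y_surj q; exists (\pi_(presented E)%qT w).
Qed.

End UniversalProperty.

(** * Translation of the presentation into structure constants *)

(** Absolute values lose nothing on [T0_2111], where these seven entries are nonnegative. *)
Definition constants_of (t : Z5) : constants :=
  Constants `|Z5_entry t 1 2 3|%N `|Z5_entry t 1 2 4|%N `|Z5_entry t 1 2 5|%N
    `|Z5_entry t 1 3 4|%N `|Z5_entry t 1 3 5|%N `|Z5_entry t 1 4 5|%N
    `|Z5_entry t 2 3 5|%N.

Lemma mem_gen_eval (X : choiceType) (Q : finGroupType) (y : X -> Q) (A : {set Q}) w :
  (forall x, y x \in A) -> eval_word y w \in <<A>>%g.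
Proof.
move=> yA; elim: w => [|[x b] w IHw] /=; first exact: group1.
by rewrite groupM // /eval_letter; case: b; rewrite /= ?groupV mem_gen.
Qed.

Lemma gen_eval (X : choiceType) (Q : finGroupType) (y : X -> Q) (A : {set Q}) q :
  (forall a, a \in A -> exists x, y x = a) -> q \in <<A>>%g ->
  exists w, q = eval_word y w.
Proof.
move=> Ay /gen_prodgP[n [c cA ->]] {q}.
elim: n c cA => [|n IHn] c cA; first by exists [::]; rewrite big_ord0.
rewrite big_ord_recl; have [i|w ->] := IHn (fun i => c (lift ord0 i)).
  exact: cA.
have [x <-] := Ay _ (cA ord0); exists ((x, false) :: w).
by [].
Qed.

Lemma enum_I5 : enum 'I_5 = [:: @Ordinal 5 0 isT; @Ordinal 5 1 isT;
  @Ordinal 5 2 isT; @Ordinal 5 3 isT; @Ordinal 5 4 isT].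
Proof. by apply: (inj_map val_inj); rewrite val_enum_ord. Qed.

Lemma I5_ind (A : 'I_5 -> Prop) :
  A (@Ordinal 5 0 isT) -> A (@Ordinal 5 1 isT) -> A (@Ordinal 5 2 isT) ->
  A (@Ordinal 5 3 isT) -> A (@Ordinal 5 4 isT) -> forall i, A i.
Proof.
move=> A0 A1 A2 A3 A4 i; have : i \in enum 'I_5 by rewrite mem_enum.
by rewrite enum_I5 !inE => /orP[|/orP[|/orP[|/orP[|]]]] /eqP->.
Qed.

Lemma commg_relP (Q : finGroupType) (x y z : Q) :
  ([~ x, y] = z <-> x * y = y * x * z)%g.
Proof.
split=> [<-|xy]; first exact: commgC.
by rewrite commgEl conjgE xy -!mulgA !mulKg.
Qed.

(** On [T0_2111] six of the ten relations have a trivial right-hand side, as empty products or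
    because entries vanish; they become [commute]. *)
Lemma Gt_relationsP (t : Z5) (Q : finGroupType) (y : 'I_5 -> Q) : T0_2111 t ->
  (forall u v, Gt_relation t u v -> eval_word y u = eval_word y v) <->
  satisfies (constants_of t) (y (@Ordinal 5 0 isT)) (y (@Ordinal 5 1 isT))
    (y (@Ordinal 5 2 isT)) (y (@Ordinal 5 3 isT)) (y (@Ordinal 5 4 isT)).
Proof.
case=> [[t123 t134 t145] [t124 t125 t135 t235] t234 t245 t345].
have pw (n : int) : 0 <= n -> forall x, eval_word y (wpow x n) = (y x ^+ `|n|%N)%g.
  by move=> n0 x; rewrite -{1}(gez0_abs n0) eval_wpow.
pose rhs (i j : 'I_5) : word 'I_5 :=
  flatten [seq wpow k (Z5_entry t i.+1 j.+1 k.+1)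
     | k : 'I_5 <- enum 'I_5 & (j < k)%N].
have rhsE (i j : 'I_5) : eval_word y (rhs i j) =
  foldr (fun (k : 'I_5) q =>
      eval_word y (wpow k (Z5_entry t i.+1 j.+1 k.+1)) * q)%g 1%g
     [seq k : 'I_5 <- enum 'I_5 | (j < k)%N].
  by rewrite /rhs; elim: filter => //= k s IHs; rewrite eval_cat IHs.
have wpow0 (x : 'I_5) : wpow x 0 = [::] by [].
have simp := (pw _ (ltW t123), pw _ (ltW t134), pw _ (ltW t145), pw _ t124,
  pw _ t125, pw _ t135, pw _ t235, t234, t245, t345, wpow0).
rewrite enum_I5 in rhsE.
split=> [yE | yP u v [i [j [ij -> ->]]]].
  have {}yE (i j : 'I_5) : (i < j)%N ->
      (y j * y i = y i * y j * eval_word y (rhs i j))%g.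
    move=> ij; apply/commg_relP; rewrite -(yE (wcomm (wgen j) (wgen i))).
      by rewrite eval_wcomm !eval_wgen.
    by exists i, j.
  have abel (i j : 'I_5) : (i < j)%N -> eval_word y (rhs i j) = 1%g ->
      commute (y j) (y i) by move=> ij r1; rewrite /commute yE // r1 mulg1.
  split; try (apply: abel => //; rewrite rhsE /= ?simp /= ?mulg1 //).
  - by rewrite yE // rhsE /= !simp mulg1 !mulgA.
  - by rewrite yE // rhsE /= !simp mulg1.
  - by rewrite yE // rhsE /= !simp mulg1.
  - by rewrite yE // rhsE /= !simp mulg1 mul1g.
rewrite eval_wcomm !eval_wgen -/(rhs i j); apply/commg_relP; rewrite rhsE.
case: yP => /= r21 r31 r41 r51 r32 r42 r52 r43 r53 r54.
move: ij; elim/I5_ind: i; elim/I5_ind: j => //= _;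
  rewrite ?simp /= ?mulg1 ?mul1g //.
by rewrite r21 !mulgA.
Qed.

Lemma finite_quotients_Gt (t : Z5) (Q : finGroupType) : T0_2111 t ->
  finite_quotients (Gt t) Q <-> is_quotient (constants_of t) Q.
Proof.
move=> tT; rewrite finite_quotients_presented.
split=> [[y yE y_surj] | [g1 [g2 [g3 [g4 [g5 [gP gQ]]]]]]].
  exists (y (@Ordinal 5 0 isT)), (y (@Ordinal 5 1 isT)), (y (@Ordinal 5 2 isT)),
    (y (@Ordinal 5 3 isT)), (y (@Ordinal 5 4 isT)).
  split; first exact/Gt_relationsP.
  apply/setP => q; rewrite finset.in_setT; have [w ->] := y_surj q.
  apply: mem_gen_eval => x; rewrite !inE.
  by elim/I5_ind: x; rewrite eqxx ?orbT.
pose y (i : 'I_5) : Q := nth g1 [:: g1; g2; g3; g4; g5] i.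
exists y; first exact/Gt_relationsP.
move=> q; apply: (@gen_eval _ _ y [set g1; g2; g3; g4; g5]%SET); last first.
  by rewrite gQ finset.in_setT.
move=> a; rewrite !inE => /orP[/orP[/orP[/orP[]|]|]|] /eqP->.
- by exists (@Ordinal 5 0 isT).
- by exists (@Ordinal 5 1 isT).
- by exists (@Ordinal 5 2 isT).
- by exists (@Ordinal 5 3 isT).
- by exists (@Ordinal 5 4 isT).
Qed.

(** * A permutation representation modulo [M] *)

Definition space (R : Type) : Type := (R * R * R * R * R)%type.

Lemma space_inj (R : Type) (x1 x2 x3 x4 x5 y1 y2 y3 y4 y5 : R) :
  (x1, x2, x3, x4, x5) = (y1, y2, y3, y4, y5) ->
  [/\ x1 = y1, x2 = y2, x3 = y3, x4 = y4 & x5 = y5].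
Proof. by case=> -> -> -> -> ->. Qed.

Section Model.
Variables (P : constants) (M : nat).
Local Notation R := 'Z_M.
Local Notation a := (ca P).
Local Notation b := (cb P).
Local Notation c := (cc P).
Local Notation d := (cd P).
Local Notation e := (ce P).
Local Notation f := (cf P).
Local Notation h := (ch P).

(* The last coordinate of [g2^k2 g3^k3 g4^k4 g5^k5] is [2 k5 - h k2 k3]: with this
   doubling [g1] acts on the last four coordinates linearly, also for even [M]. *)
Definition model_fun1 (x : space R) : space R :=
  let: (x1, x2, x3, x4, x5) := x in
  (x1 + 1, x2, x3 + x2 *+ a, x4 + x3 *+ d + x2 *+ b,
   x5 + x4 *+ (2 * f) + x3 *+ (2 * e) + x2 *+ (2 * c) - x2 *+ (h * a)).

Definition model_fun2 (x : space R) : space R :=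
  let: (x1, x2, x3, x4, x5) := x in (x1, x2 + 1, x3, x4, x5 + x3 *+ h).

Definition model_fun3 (x : space R) : space R :=
  let: (x1, x2, x3, x4, x5) := x in (x1, x2, x3 + 1, x4, x5 - x2 *+ h).

Definition model_fun4 (x : space R) : space R :=
  let: (x1, x2, x3, x4, x5) := x in (x1, x2, x3, x4 + 1, x5).

Definition model_fun5 (x : space R) : space R :=
  let: (x1, x2, x3, x4, x5) := x in (x1, x2, x3, x4, x5 + 2%:R).

Lemma model_fun1_inj : injective model_fun1.
Proof.
move=> [[[[x1 x2] x3] x4] x5] [[[[y1 y2] y3] y4] y5] E; case: (space_inj E).
by move=> /addIr-> -> /addIr-> /addIr/addIr-> /addIr/addIr/addIr/addIr->.
Qed.

Lemma model_fun2_inj : injective model_fun2.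
Proof.
move=> [[[[x1 x2] x3] x4] x5] [[[[y1 y2] y3] y4] y5] E; case: (space_inj E).
by move=> -> /addIr-> -> -> /addIr->.
Qed.

Lemma model_fun3_inj : injective model_fun3.
Proof.
move=> [[[[x1 x2] x3] x4] x5] [[[[y1 y2] y3] y4] y5] E; case: (space_inj E).
by move=> -> -> /addIr-> -> /addIr->.
Qed.

Lemma model_fun4_inj : injective model_fun4.
Proof.
move=> [[[[x1 x2] x3] x4] x5] [[[[y1 y2] y3] y4] y5] E; case: (space_inj E).
by move=> -> -> -> /addIr-> ->.
Qed.

Lemma model_fun5_inj : injective model_fun5.
Proof.
move=> [[[[x1 x2] x3] x4] x5] [[[[y1 y2] y3] y4] y5] E; case: (space_inj E).
by move=> -> -> -> -> /addIr->.
Qed.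

Definition model_g1 : {perm space R} := perm model_fun1_inj.
Definition model_g2 : {perm space R} := perm model_fun2_inj.
Definition model_g3 : {perm space R} := perm model_fun3_inj.
Definition model_g4 : {perm space R} := perm model_fun4_inj.
Definition model_g5 : {perm space R} := perm model_fun5_inj.

Lemma zpow_perm (T : finType) (s : {perm T}) (F : int -> T -> T) n x :
  (forall x, F 0 x = x) -> (forall n x, F (n + 1) x = s (F n x)) ->
  zpow s n x = F n x.
Proof.
move=> F0 FS; elim/int_ind: n x => [|n IHn|n IHn] x; first by rewrite F0 perm1.
  by rewrite PoszS zpowS permM IHn FS.
apply: (@perm_inj _ s); rewrite -permM -zpowS -FS.
by rewrite PoszS opprD addrNK.
Qed.

Lemma eq_space (x1 x2 x3 x4 x5 y1 y2 y3 y4 y5 : R) :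
  x1 = y1 -> x2 = y2 -> x3 = y3 -> x4 = y4 -> x5 = y5 ->
  (x1, x2, x3, x4, x5) = (y1, y2, y3, y4, y5).
Proof. by move=> -> -> -> -> ->. Qed.

Lemma zpow_model_g2 n x1 x2 x3 x4 x5 : zpow model_g2 n (x1, x2, x3, x4, x5)
  = (x1, x2 + n%:~R, x3, x4, x5 + x3 *+ h *~ n).
Proof.
rewrite (@zpow_perm _ _ (fun n '(x1, x2, x3, x4, x5) =>
  (x1, x2 + n%:~R, x3, x4, x5 + x3 *+ h *~ n))) // => {x1 x2 x3 x4 x5 n}.
  by move=> [[[[x1 x2] x3] x4] x5]; rewrite !mulr0z !addr0.
by move=> n [[[[x1 x2] x3] x4] x5]; rewrite permE; apply: eq_space => //; ring.
Qed.

Lemma zpow_model_g3 n x1 x2 x3 x4 x5 : zpow model_g3 n (x1, x2, x3, x4, x5)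
  = (x1, x2, x3 + n%:~R, x4, x5 - x2 *+ h *~ n).
Proof.
rewrite (@zpow_perm _ _ (fun n '(x1, x2, x3, x4, x5) =>
  (x1, x2, x3 + n%:~R, x4, x5 - x2 *+ h *~ n))) // => {x1 x2 x3 x4 x5 n}.
  by move=> [[[[x1 x2] x3] x4] x5]; rewrite !mulr0z addr0 subr0.
by move=> n [[[[x1 x2] x3] x4] x5]; rewrite permE; apply: eq_space => //; ring.
Qed.

Lemma zpow_model_g4 n x1 x2 x3 x4 x5 : zpow model_g4 n (x1, x2, x3, x4, x5)
  = (x1, x2, x3, x4 + n%:~R, x5).
Proof.
rewrite (@zpow_perm _ _ (fun n '(x1, x2, x3, x4, x5) =>
  (x1, x2, x3, x4 + n%:~R, x5))) // => {x1 x2 x3 x4 x5 n}.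
  by move=> [[[[x1 x2] x3] x4] x5]; rewrite !mulr0z addr0.
by move=> n [[[[x1 x2] x3] x4] x5]; rewrite permE; apply: eq_space => //; ring.
Qed.

Lemma zpow_model_g5 n x1 x2 x3 x4 x5 : zpow model_g5 n (x1, x2, x3, x4, x5)
  = (x1, x2, x3, x4, x5 + 2%:R *~ n).
Proof.
rewrite (@zpow_perm _ _ (fun n '(x1, x2, x3, x4, x5) =>
  (x1, x2, x3, x4, x5 + 2%:R *~ n))) // => {x1 x2 x3 x4 x5 n}.
  by move=> [[[[x1 x2] x3] x4] x5]; rewrite !mulr0z addr0.
by move=> n [[[[x1 x2] x3] x4] x5]; rewrite permE; apply: eq_space => //; ring.
Qed.

Lemma exp_model_g1 n x1 x2 x3 x4 x5 : (model_g1 ^+ n)%g (x1, x2, x3, x4, x5)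
  = (x1 + n%:R, x2, x3 + a%:R * n%:R * x2,
     x4 + d%:R * n%:R * x3 + (b%:R * n%:R + a%:R * d%:R * 'C(n, 2)%:R) * x2,
     x5 + 2%:R * f%:R * n%:R * x4
     + 2%:R * (e%:R * n%:R + d%:R * f%:R * 'C(n, 2)%:R) * x3
     + ((2%:R * c%:R - h%:R * a%:R) * n%:R
        + 2%:R * (a%:R * e%:R + b%:R * f%:R) * 'C(n, 2)%:R
        + 2%:R * a%:R * d%:R * f%:R * 'C(n, 3)%:R) * x2).
Proof.
elim: n x1 x2 x3 x4 x5 => [|n IHn] x1 x2 x3 x4 x5.
  by rewrite expg0 perm1; apply: eq_space => //; rewrite ?bin0n /=; ring.
rewrite expgSr permM IHn permE.
by apply: eq_space => //; rewrite ?binS ?bin1; ring.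
Qed.

Lemma satisfies_model : satisfies P model_g1 model_g2 model_g3 model_g4 model_g5.
Proof.
split; rewrite /commute; apply/permP => -[[[[x1 x2] x3] x4] x5];
  rewrite !permM !permE /= ?(zpow_model_g3 a) ?(zpow_model_g4 b) ?(zpow_model_g4 d)
    ?(zpow_model_g5 c) ?(zpow_model_g5 e) ?(zpow_model_g5 f) ?(zpow_model_g5 h) -?pmulrn;
  apply: eq_space => //; ring.
Qed.

End Model.

Section Elements.
Variables (P : constants) (M : nat).

Definition model_nf (k2 k3 k4 k5 : int) : {perm space 'Z_M} :=
  nf (model_g2 P M) (model_g3 P M) (model_g4 M) (model_g5 M) k2 k3 k4 k5.

Definition model_elt (k : nat * nat * int * int * int) : {perm space 'Z_M} :=
  let: (k1, k2, k3, k4, k5) := k in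
  (model_g1 P M ^+ k1 * model_nf k2%:Z k3 k4 k5)%g.

End Elements.

(** * Reduction of the modulus *)

Section Reduction.
Variables (P : constants) (M N : nat).
Hypotheses (M_gt1 : (1 < M)%N) (N_gt1 : (1 < N)%N) (NM : (N %| M)%N).

Definition red (x : 'Z_M) : 'Z_N := (val x)%:R.

Lemma red_nat n : red n%:R = n%:R.
Proof.
by rewrite /red !Zp_nat; apply/val_inj; rewrite /= !Zp_cast // modn_dvdm.
Qed.

Lemma redD x y : red (x + y) = red x + red y.
Proof. by rewrite -[x]natr_Zp -[y]natr_Zp -natrD !red_nat natrD. Qed.

Lemma redMn x n : red (x *+ n) = red x *+ n.
Proof. by rewrite -[x]natr_Zp -mulrnA !red_nat -mulrnA. Qed.

Lemma redN x : red (- x) = - red x.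
Proof. by apply: (addrI (red x)); rewrite -redD !subrr (red_nat 0). Qed.

Definition red_space (x : space 'Z_M) : space 'Z_N :=
  let: (x1, x2, x3, x4, x5) := x in (red x1, red x2, red x3, red x4, red x5).

Lemma red_space_surj y : exists x, red_space x = y.
Proof.
have redK (t : 'Z_N) : red (val t)%:R = t by rewrite red_nat natr_Zp.
case: y => [[[[y1 y2] y3] y4] y5].
exists ((val y1)%:R, (val y2)%:R, (val y3)%:R, (val y4)%:R, (val y5)%:R).
by rewrite /red_space !redK.
Qed.

(** A relation and not a map: a general permutation of the larger space induces none on the smaller
    one. When it does, the induced one is unique because [red_space] is surjective. *)
Definition reduces_to (s : {perm space 'Z_M}) (s' : {perm space 'Z_N}) : Prop :=
  forall x, red_space (s x) = s' (red_space x).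

Lemma reduces_to_inj s s' t' : reduces_to s s' -> reduces_to s t' -> s' = t'.
Proof.
by move=> ss' st'; apply/permP => y; have [x <-] := red_space_surj y;
   rewrite -ss' -st'.
Qed.

Lemma reduces_to1 : reduces_to 1 1.
Proof. by move=> x; rewrite !perm1. Qed.

Lemma reduces_toM s s' t t' :
  reduces_to s s' -> reduces_to t t' -> reduces_to (s * t)%g (s' * t')%g.
Proof. by move=> ss' tt' x; rewrite !permM tt' ss'. Qed.

Lemma reduces_toV s s' : reduces_to s s' -> reduces_to s^-1%g s'^-1%g.
Proof. by move=> ss' x; apply: (@perm_inj _ s'); rewrite permKV -ss' permKV. Qed.

Lemma reduces_toX s s' n : reduces_to s s' -> reduces_to (s ^+ n)%g (s' ^+ n)%g.
Proof.
move=> ss'; elim: n => [|n IHn]; first exact: reduces_to1.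
by rewrite !expgS; exact: reduces_toM.
Qed.

Lemma reduces_to_zpow s s' n : reduces_to s s' -> reduces_to (zpow s n) (zpow s' n).
Proof. by move=> ss'; case: n => n; last apply: reduces_toV; exact: reduces_toX. Qed.

Lemma reduces_to_elt k : reduces_to (model_elt P M k) (model_elt P N k).
Proof.
have r1 : reduces_to (model_g1 P M) (model_g1 P N).
  move=> [[[[x1 x2] x3] x4] x5]; rewrite !permE /=.
  by rewrite !(redD, redMn, redN) (red_nat 1).
have r2 : reduces_to (model_g2 P M) (model_g2 P N).
  by move=> [[[[x1 x2] x3] x4] x5]; rewrite !permE /= !(redD, redMn) (red_nat 1).
have r3 : reduces_to (model_g3 P M) (model_g3 P N).
  by move=> [[[[x1 x2] x3] x4] x5];
     rewrite !permE /= !(redD, redMn, redN) (red_nat 1).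
have r4 : reduces_to (model_g4 M) (model_g4 N).
  by move=> [[[[x1 x2] x3] x4] x5]; rewrite !permE /= redD (red_nat 1).
have r5 : reduces_to (model_g5 M) (model_g5 N).
  by move=> [[[[x1 x2] x3] x4] x5]; rewrite !permE /= redD (red_nat 2).
case: k => [[[[k1 k2] k3] k4] k5]; rewrite /model_elt /model_nf /nf.
by do !apply: reduces_toM; (exact: reduces_toX || exact: reduces_to_zpow).
Qed.

Lemma satisfies_reduce P' k1 k2 k3 k4 k5 :
  satisfies P' (model_elt P M k1) (model_elt P M k2) (model_elt P M k3)
    (model_elt P M k4) (model_elt P M k5) ->
  satisfies P' (model_elt P N k1) (model_elt P N k2) (model_elt P N k3)
    (model_elt P N k4) (model_elt P N k5).
Proof.
have rM := reduces_toM; have rX := reduces_toX; have rE := reduces_to_elt.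
have eqr s s' t t' : reduces_to s s' -> reduces_to t t' -> s = t -> s' = t'.
  by move=> ss' tt' st; rewrite st in ss'; exact: reduces_to_inj ss' tt'.
case=> r21 r31 r41 r51 r32 r42 r52 r43 r53 r54.
split; rewrite /commute; [apply: eqr r21 | apply: eqr r31 | apply: eqr r41
  | apply: eqr r51 | apply: eqr r32 | apply: eqr r42 | apply: eqr r52
  | apply: eqr r43 | apply: eqr r53 | apply: eqr r54];
  repeat (apply rE || apply rX || apply rM).
Qed.

End Reduction.

(** * Generators of a quotient yield solutions *)

Lemma satisfies_morph P (G H : groupType) (phi : G -> H) g1 g2 g3 g4 g5 :
  {morph phi : x y / (x * y)%g} -> satisfies P g1 g2 g3 g4 g5 ->
  satisfies P (phi g1) (phi g2) (phi g3) (phi g4) (phi g5).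
Proof.
move=> phiM; have phi1 : phi 1%g = 1%g.
  by apply: (mulgI (phi 1%g)); rewrite -phiM !mulg1.
have phiX x n : phi (x ^+ n)%g = (phi x ^+ n)%g.
  by elim: n => [|n IHn]; rewrite ?expg0 // !expgS phiM IHn.
case=> r21 r31 r41 r51 r32 r42 r52 r43 r53 r54.
by split; rewrite /commute -?phiX -!phiM; congr phi.
Qed.

Lemma satisfies_inj P (G H : groupType) (phi : G -> H) g1 g2 g3 g4 g5 :
  {morph phi : x y / (x * y)%g} -> injective phi ->
  satisfies P (phi g1) (phi g2) (phi g3) (phi g4) (phi g5) ->
  satisfies P g1 g2 g3 g4 g5.
Proof.
move=> phiM phi_inj; have phi1 : phi 1%g = 1%g.
  by apply: (mulgI (phi 1%g)); rewrite -phiM !mulg1.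
have phiX x n : phi (x ^+ n)%g = (phi x ^+ n)%g.
  by elim: n => [|n IHn]; rewrite ?expg0 // !expgS phiM IHn.
case=> r21 r31 r41 r51 r32 r42 r52 r43 r53 r54.
by split; apply: phi_inj; rewrite !phiM ?phiX.
Qed.

(** [is_quotient] speaks of a whole group, so the subgroup generated by the [gi] is made a group of
    its own, and the new generators are carried back along [sgval]. *)
Lemma is_quotient_gen P P' (gT : finGroupType) (g1 g2 g3 g4 g5 : gT) :
  (forall Q, is_quotient P Q -> is_quotient P' Q) -> satisfies P g1 g2 g3 g4 g5 ->
  exists y1 y2 y3 y4 y5 : gT, satisfies P' y1 y2 y3 y4 y5 /\
    <<[set y1; y2; y3; y4; y5]>>%g = <<[set g1; g2; g3; g4; g5]>>%g.
Proof.
move=> PP' gP; pose K := <<[set g1; g2; g3; g4; g5]>>%G.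
have inK x : x \in [set g1; g2; g3; g4; g5] -> sgval (subg K x) = x.
  by move=> xg; rewrite subgK // mem_gen.
have sM : {morph (@sgval _ K) : x y / (x * y)%g} by [].
have sub5 (A : {group gT}) (x1 x2 x3 x4 x5 : gT) : [set x1; x2; x3; x4; x5] \subset A ->
    [/\ x1 \in A, x2 \in A, x3 \in A, x4 \in A & x5 \in A].
  by move/fintype.subsetP => sA; split; apply: sA; rewrite !inE eqxx ?orbT.
have KQ : is_quotient P (subg_of K).
  exists (subg K g1), (subg K g2), (subg K g3), (subg K g4), (subg K g5); split.
    apply: (satisfies_inj sM (@subg_inj _ K)).
    by rewrite !inK // !inE eqxx ?orbT.
  rewrite -(im_subg K) /= morphim_gen ?subset_gen //; congr <<_>>%g.
  have [] := sub5 K _ _ _ _ _ (subset_gen _) => K1 K2 K3 K4 K5.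
  by rewrite !morphimU !morphim_set1.
have [y1 [y2 [y3 [y4 [y5 [yP yQ]]]]]] := PP' _ KQ.
exists (sgval y1), (sgval y2), (sgval y3), (sgval y4), (sgval y5).
split; first exact: satisfies_morph yP.
transitivity (sgval @* <<[set y1; y2; y3; y4; y5]>>)%g; last by rewrite yQ im_sgval.
rewrite morphim_gen ?finset.subsetT //; congr <<_>>%g.
by rewrite !morphimU !morphim_set1 ?finset.in_setT.
Qed.

(** * Reading off exponents from the action *)

Section Affine.
Variables (P : constants) (M : nat).
Hypothesis M_gt1 : (1 < M)%N.
Local Notation R := 'Z_M.
Local Notation S := {perm space R}.

(* The action on the first three coordinates is that of a Heisenberg group. *)
Definition heis (s : S) (k1 k2 k3 : R) : Prop := forall x1 x2 x3 x4 x5,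
  exists y4 y5, s (x1, x2, x3, x4, x5)
    = (x1 + k1, x2 + k2, x3 + (ca P)%:R * x2 * k1 + k3, y4, y5).

Lemma heis_inj s k1 k2 k3 l1 l2 l3 :
  heis s k1 k2 k3 -> heis s l1 l2 l3 -> [/\ k1 = l1, k2 = l2 & k3 = l3].
Proof.
move=> ks ls; have [y4 [y5 Ey]] := ks 0 0 0 0 0; have [z4 [z5 Ez]] := ls 0 0 0 0 0.
have [] := space_inj (etrans (esym Ey) Ez); rewrite !mulr0 !mul0r !add0r => -> -> -> _ _.
by [].
Qed.

Lemma heisM s t k1 k2 k3 l1 l2 l3 : heis s k1 k2 k3 -> heis t l1 l2 l3 ->
  heis (s * t)%g (k1 + l1) (k2 + l2) (k3 + l3 + (ca P)%:R * k2 * l1).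
Proof.
move=> ks lt x1 x2 x3 x4 x5; rewrite permM.
have [y4 [y5 ->]] := ks x1 x2 x3 x4 x5.
have [z4 [z5 ->]] := lt (x1 + k1) (x2 + k2) (x3 + (ca P)%:R * x2 * k1 + k3) y4 y5.
by exists z4, z5; apply: eq_space => //; ring.
Qed.

Lemma heis1 : heis 1%g 0 0 0.
Proof.
move=> x1 x2 x3 x4 x5; exists x4, x5; rewrite perm1.
by apply: eq_space => //; ring.
Qed.

Lemma heisX s k1 k2 k3 n : heis s k1 k2 k3 ->
  exists l3, heis (s ^+ n)%g (k1 *+ n) (k2 *+ n) l3.
Proof.
move=> ks; elim: n => [|n [l IHn]]; first by exists 0; exact: heis1.
by eexists; rewrite expgSr !mulrSr; apply: heisM IHn ks.
Qed.

Lemma heisX0 s k3 n : heis s 0 0 k3 -> heis (s ^+ n)%g 0 0 (k3 *+ n).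
Proof.
move=> ks; elim: n => [|n IHn]; first exact: heis1.
have := heisM IHn ks; rewrite -expgSr !mulr0 !addr0.
by rewrite mulrSr.
Qed.

Lemma heis_elt k1 k2 k3 k4 k5 :
  heis (model_elt P M (k1, k2, k3, k4, k5)) k1%:R k2%:R k3%:~R.
Proof.
move=> x1 x2 x3 x4 x5; rewrite /model_elt /model_nf /nf !permM exp_model_g1.
rewrite zpow_model_g2 zpow_model_g3 zpow_model_g4 zpow_model_g5; do 2!eexists.
by apply: eq_space; [ | | |reflexivity|reflexivity]; rewrite -?pmulrn; ring.
Qed.

(** The origin is sent to the point with coordinates 0, k2, k3, k4 and 2 k5 - h k2 k3, whence the
    factor 2 in the last divisibility. *)
Lemma model_nf_inj k2 k3 k4 k5 l2 l3 l4 l5 :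
  model_nf P M k2 k3 k4 k5 = model_nf P M l2 l3 l4 l5 ->
  [/\ (M%:Z %| k2 - l2)%Z, (M%:Z %| k3 - l3)%Z, (M%:Z %| k4 - l4)%Z
     & (M%:Z %| 2 * (k5 - l5))%Z].
Proof.
move/permP/(_ (0, 0, 0, 0, 0)).
rewrite /model_nf /nf !permM !zpow_model_g2 !zpow_model_g3 !zpow_model_g4 !zpow_model_g5.
move=> E; have [_ {E}] := space_inj E; rewrite !add0r => E2 E3 E4 E5.
split; try (by rewrite -eq_intZp //; apply/eqP).
rewrite -intZp_eq0 //; apply/eqP.
have -> : (2 * (k5 - l5))%:~R = (ch P)%:R * (k2%:~R * k3%:~R - l2%:~R * l3%:~R)
    + ((0 *+ ch P *~ k2 - k2%:~R *+ ch P *~ k3 + 2%:R *~ k5)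
      - (0 *+ ch P *~ l2 - l2%:~R *+ ch P *~ l3 + 2%:R *~ l5)) :> R by ring.
by rewrite E5 E2 E3 !subrr mulr0 addr0.
Qed.

Lemma zpow_model1 s k : s \in [:: model_g2 P M; model_g3 P M; model_g4 M; model_g5 M] ->
  (M%:Z %| k)%Z -> zpow s k = 1%g.
Proof.
move=> sP; rewrite -intZp_eq0 // => /eqP k0.
have z (x : R) : x *~ k = 0 by rewrite -mulrzr k0 mulr0.
apply/permP => -[[[[x1 x2] x3] x4] x5]; rewrite perm1.
move: sP; rewrite !inE => /orP[|/orP[|/orP[|]]] /eqP->.
- by rewrite zpow_model_g2 !z !addr0.
- by rewrite zpow_model_g3 !z subr0 !addr0.
- by rewrite zpow_model_g4 !z !addr0.
- by rewrite zpow_model_g5 !z !addr0.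
Qed.

(** By [exp_model_g1] the action of [g1 ^+ K] depends on [K] and on two binomial coefficients, and
    all three vanish modulo [M]. *)
Lemma exp_model_g1_eq1 K k : (M %| K)%N -> (M %| 'C(K, 2))%N -> (M %| 'C(K, 3))%N ->
  (K %| k)%N -> (model_g1 P M ^+ k)%g = 1%g.
Proof.
have nat0 n : (M %| n)%N -> n%:R = 0 :> R.
  by move=> Mn; apply/eqP; rewrite pmulrn intZp_eq0.
move=> /nat0 K1 /nat0 K2 /nat0 K3 /dvdnP[n ->]; rewrite mulnC expgnA.
suff -> : (model_g1 P M ^+ K)%g = 1%g by rewrite expg1n.
apply/permP => -[[[[x1 x2] x3] x4] x5]; rewrite exp_model_g1 perm1 K1 K2 K3.
by apply: eq_space; ring.
Qed.

End Affine.

(** The triangular system is solved from [k5] upwards; the factors [f], [d], [a] of the modulus pay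
    for the successive cancellations. *)
Lemma torsion_dvdn (a b c d e f M k3 k4 k5 : nat) :
  (0 < a)%N -> (0 < d)%N -> (0 < f)%N -> let N := (M * a * d * f)%N in
  (N %| k5 * f)%N -> (N %| k4 * d + k5 * e)%N -> (N %| k3 * a + k4 * b + k5 * c)%N ->
  [/\ (M %| k3)%N, (M %| k4)%N & (M %| k5)%N].
Proof.
move=> a0 d0 f0 /=; rewrite dvdn_pmul2r // => k5P k4P k3P.
have {}k4P : (M * a %| k4)%N.
  have : (M * a * d %| k4 * d + k5 * e)%N by apply: dvdn_trans k4P; rewrite dvdn_mulr.
  by rewrite (dvdn_addl _ (dvdn_mulr e k5P)) dvdn_pmul2r.
have {}k5P : (M * a %| k5)%N by apply: dvdn_trans k5P; rewrite dvdn_mulr.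
have : (M * a %| k3 * a + k4 * b + k5 * c)%N.
  by apply: dvdn_trans k3P; rewrite -mulnA dvdn_mulr.
rewrite -addnA (dvdn_addl _ (dvdn_add (dvdn_mulr b k4P) (dvdn_mulr c k5P))).
rewrite dvdn_pmul2r // => {}k3P.
by split=> //; [apply: dvdn_trans k4P | apply: dvdn_trans k5P]; rewrite dvdn_mulr.
Qed.

Lemma dvdz_add (d m n : int) : (d %| m)%Z -> (d %| n)%Z -> (d %| m + n)%Z.
Proof. exact: rpredD. Qed.

Section QuotientExponents.
Variables (P P' : constants) (p M : nat).
Hypotheses (p_pr : prime p) (pM : (p %| M)%N) (M_gt0 : (0 < M)%N).
Hypotheses (a_gt0 : (0 < ca P')%N) (d_gt0 : (0 < cd P')%N) (f_gt0 : (0 < cf P')%N).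
Hypothesis PP' : forall Q, is_quotient P Q -> is_quotient P' Q.
Let N := (M * ca P' * cd P' * cf P')%N.

Lemma quotient_modulus_gt1 : (1 < N)%N.
Proof.
apply: leq_trans (prime_gt1 p_pr) _; apply: dvdn_leq.
  by rewrite /N !muln_gt0 M_gt0 a_gt0 d_gt0.
by rewrite /N -!mulnA dvdn_mulr.
Qed.

(** The first two coordinates are additive, so the relations of [P'] become linear congruences for
    the exponents of [g1] and [g2], which [torsion_dvdn] solves. Thus [y3], [y4], [y5] contribute
    nothing modulo [p], and [y1], [y2] alone must produce [g1] and [g2]: their exponent matrix is
    invertible modulo [p]. *)
Lemma quotient_exponents : exists (k11 k12 k21 k22 k31 k32 k41 k42 k51 k52 : nat)
    (k13 k14 k15 k23 k24 k25 k33 k34 k35 k43 k44 k45 k53 k54 k55 : int),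
  [/\ satisfies P' (model_elt P N (k11, k12, k13, k14, k15))
        (model_elt P N (k21, k22, k23, k24, k25))
        (model_elt P N (k31, k32, k33, k34, k35))
        (model_elt P N (k41, k42, k43, k44, k45))
        (model_elt P N (k51, k52, k53, k54, k55)),
      [/\ (M %| k31)%N, (M %| k41)%N & (M %| k51)%N],
      [/\ (M %| k32)%N, (M %| k42)%N & (M %| k52)%N] &
      ~~ (p%:Z %| k11%:Z * k22%:Z - k21%:Z * k12%:Z)%Z].
Proof.
have N_gt1 := quotient_modulus_gt1.
have [y1 [y2 [y3 [y4 [y5 [yP yQ]]]]]] := is_quotient_gen PP' (satisfies_model P N).
have nfP y : y \in [set y1; y2; y3; y4; y5] ->
    exists (k1 k2 : nat) (k3 k4 k5 : int), y = model_elt P N (k1, k2, k3, k4, k5).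
  move=> yS; apply: (gen_normal_form (satisfies_model P N)).
  by rewrite -yQ mem_gen.
have [k11 [k12 [k13 [k14 [k15 y1E]]]]] : _ := nfP y1 ltac:(by rewrite !inE eqxx ?orbT).
have [k21 [k22 [k23 [k24 [k25 y2E]]]]] : _ := nfP y2 ltac:(by rewrite !inE eqxx ?orbT).
have [k31 [k32 [k33 [k34 [k35 y3E]]]]] : _ := nfP y3 ltac:(by rewrite !inE eqxx ?orbT).
have [k41 [k42 [k43 [k44 [k45 y4E]]]]] : _ := nfP y4 ltac:(by rewrite !inE eqxx ?orbT).
have [k51 [k52 [k53 [k54 [k55 y5E]]]]] : _ := nfP y5 ltac:(by rewrite !inE eqxx ?orbT).
exists k11, k12, k21, k22, k31, k32, k41, k42, k51, k52.
exists k13, k14, k15, k23, k24, k25, k33, k34, k35, k43, k44, k45, k53, k54, k55.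
rewrite -y1E -y2E -y3E -y4E -y5E.
have h1 := @heis_elt P N k11 k12 k13 k14 k15; rewrite -y1E in h1.
have h2 := @heis_elt P N k21 k22 k23 k24 k25; rewrite -y2E in h2.
have h3 := @heis_elt P N k31 k32 k33 k34 k35; rewrite -y3E in h3.
have h4 := @heis_elt P N k41 k42 k43 k44 k45; rewrite -y4E in h4.
have h5 := @heis_elt P N k51 k52 k53 k54 k55; rewrite -y5E in h5.
have dvdN k : k%:R = 0 :> 'Z_N -> (N %| k)%N.
  by move/eqP; rewrite pmulrn intZp_eq0.
(* Both orders of a product have the same first two coordinates, so those of the commutator [r] are
   zero. *)
have swap (s t r : {perm space 'Z_N}) k1 k2 k3 l1 l2 l3 m1 m2 m3 :
    heis P s k1 k2 k3 -> heis P t l1 l2 l3 -> heis P r m1 m2 m3 ->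
    (s * t = t * s * r)%g -> m1 = 0 /\ m2 = 0.
  move=> hs ht hr st; have := heisM hs ht; rewrite st => hst.
  have [E1 E2 _] := heis_inj hst (heisM (heisM ht hs) hr).
  split; [apply: (addrI (l1 + k1)) | apply: (addrI (l2 + k2))].
    by rewrite -E1 addr0 addrC.
  by rewrite -E2 addr0 addrC.
have [k51P k52P] : (N %| k51 * cf P')%N /\ (N %| k52 * cf P')%N.
  have [l3 hX] := heisX (cf P') h5.
  have [E1 E2] := swap _ _ _ _ _ _ _ _ _ _ _ _ h4 h1 hX (rel41 yP).
  by split; apply: dvdN; rewrite natrM mulr_natr.
have [k41P k42P] : (N %| k41 * cd P' + k51 * ce P')%N /\
    (N %| k42 * cd P' + k52 * ce P')%N.
  have [l4 hX4] := heisX (cd P') h4; have [l5 hX5] := heisX (ce P') h5.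
  have [E1 E2] := swap _ _ _ _ _ _ _ _ _ _ _ _ h3 h1 (heisM hX4 hX5) (rel31 yP).
  by split; apply: dvdN; rewrite natrD !natrM !mulr_natr.
have [k31P k32P] : (N %| k31 * ca P' + k41 * cb P' + k51 * cc P')%N /\
    (N %| k32 * ca P' + k42 * cb P' + k52 * cc P')%N.
  have [l3 hX3] := heisX (ca P') h3; have [l4 hX4] := heisX (cb P') h4.
  have [l5 hX5] := heisX (cc P') h5.
  have [E1 E2] := swap _ _ _ _ _ _ _ _ _ _ _ _ h2 h1
    (heisM (heisM hX3 hX4) hX5) (rel21 yP).
  by split; apply: dvdN; rewrite !natrD !natrM !mulr_natr.
have [M31 M41 M51] := torsion_dvdn a_gt0 d_gt0 f_gt0 k51P k41P k31P.
have [M32 M42 M52] := torsion_dvdn a_gt0 d_gt0 f_gt0 k52P k42P k32P.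
split=> //.
have pN : (p%:Z %| N%:Z)%Z by rewrite /N dvdzE /= -!mulnA dvdn_mulr.
have span (x : {perm space 'Z_N}) (K1 K2 : int) K3 :
    x \in <<[set y1; y2; y3; y4; y5]>>%g -> heis P x K1%:~R K2%:~R K3 ->
    exists u v : int, (p%:Z %| K1 - (u * k11%:Z + v * k21%:Z))%Z /\
      (p%:Z %| K2 - (u * k12%:Z + v * k22%:Z))%Z.
  move=> xS hx.
  suff [L1 [L2 [L3 [u [v [hL u1 u2]]]]]] : exists (L1 L2 : int) L3 (u v : int),
      [/\ heis P x L1%:~R L2%:~R L3, (p%:Z %| L1 - (u * k11%:Z + v * k21%:Z))%Z
        & (p%:Z %| L2 - (u * k12%:Z + v * k22%:Z))%Z].
    have [/eqP E1 /eqP E2 _] := heis_inj hx hL.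
    rewrite eq_intZp // in E1; rewrite eq_intZp // in E2.
    exists u, v; split.
      by rewrite -(subrK L1 K1) -addrA dvdz_add // (dvdz_trans pN).
    by rewrite -(subrK L2 K2) -addrA dvdz_add // (dvdz_trans pN).
  have [n [c cS ->]] := gen_prodgP xS.
  elim: n c cS => [|n IHn] c cS.
    exists 0, 0, 0, 0, 0; rewrite big_ord0 !mul0r !addr0.
    by split; [exact: heis1 | rewrite dvdz0 | rewrite dvdz0].
  rewrite big_ord_recr /=.
  have [i|L1 [L2 [L3 [u [v [hL u1 u2]]]]]] := IHn (fun i => c (widen_ord (leqnSn n) i)).
    exact: cS.
  have step (y : {perm space 'Z_N}) (m1 m2 : nat) (m3 : 'Z_N) (du dv : int) :
      heis P y m1%:R m2%:R m3 ->
      (p%:Z %| m1%:Z - (du * k11%:Z + dv * k21%:Z))%Z ->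
      (p%:Z %| m2%:Z - (du * k12%:Z + dv * k22%:Z))%Z ->
      exists (L1 L2 : int) L3 (u v : int),
      [/\ heis P (\prod_(i < n) c (widen_ord (leqnSn n) i) * y)%g L1%:~R L2%:~R L3,
        (p%:Z %| L1 - (u * k11%:Z + v * k21%:Z))%Z
        & (p%:Z %| L2 - (u * k12%:Z + v * k22%:Z))%Z].
    move=> hy d1 d2; exists (L1 + m1%:Z), (L2 + m2%:Z); eexists.
    exists (u + du), (v + dv); split.
    - by rewrite !intrD -!pmulrn; exact: heisM hL hy.
    - rewrite (_ : _ - _ = (L1 - (u * k11%:Z + v * k21%:Z)) +
        (m1%:Z - (du * k11%:Z + dv * k21%:Z))); [exact: dvdz_add | ring].
    - rewrite (_ : _ - _ = (L2 - (u * k12%:Z + v * k22%:Z)) +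
        (m2%:Z - (du * k12%:Z + dv * k22%:Z))); [exact: dvdz_add | ring].
  have dvdp k : (M %| k)%N -> (p%:Z %| k%:Z - (0 * k11%:Z + 0 * k21%:Z))%Z.
    by move=> Mk; rewrite !mul0r !addr0 ?subr0 dvdzE /= (dvdn_trans pM).
  have := cS ord_max; rewrite !inE.
  case/orP=> [|/eqP->]; last by apply: (step _ _ _ _ 0 0 h5); exact: dvdp.
  case/orP=> [|/eqP->]; last by apply: (step _ _ _ _ 0 0 h4); exact: dvdp.
  case/orP=> [|/eqP->]; last by apply: (step _ _ _ _ 0 0 h3); exact: dvdp.
  case/orP=> /eqP->.
    by apply: (step _ _ _ _ 1 0 h1); rewrite !mul1r !mul0r addr0 subrr dvdz0.
  by apply: (step _ _ _ _ 0 1 h2); rewrite !mul1r !mul0r add0r subrr dvdz0.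
have mem_mod s :
    s \in [set model_g1 P N; model_g2 P N; model_g3 P N; model_g4 N; model_g5 N] ->
    s \in <<[set y1; y2; y3; y4; y5]>>%g.
  by move=> sm; rewrite yQ mem_gen.
have [u1 [v1 [A1 B1]]] : exists u v : int, (p%:Z %| 1 - (u * k11%:Z + v * k21%:Z))%Z /\
      (p%:Z %| 0 - (u * k12%:Z + v * k22%:Z))%Z.
  apply: (span (model_g1 P N) _ _ 0); first by rewrite mem_mod // !inE eqxx.
  have := @heis_elt P N 1 0 0 0 0.
  by rewrite /model_elt /model_nf nf1 mulg1 expg1.
have [u2 [v2 [A2 B2]]] : exists u v : int, (p%:Z %| 0 - (u * k11%:Z + v * k21%:Z))%Z /\
      (p%:Z %| 1 - (u * k12%:Z + v * k22%:Z))%Z.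
  apply: (span (model_g2 P N) _ _ 0); first by rewrite mem_mod // !inE eqxx orbT.
  have := @heis_elt P N 0 1 0 0 0.
  by rewrite /model_elt /model_nf nf2 mul1g zpow1.
apply/negP => pD.
(* The coefficients expressing [g1] and [g2] form an inverse of the exponent matrix modulo [p];
   multiplicativity of determinants gives this identity, in which [p] would divide every summand. *)
have E : 1 = (1 - (u1 * k11%:Z + v1 * k21%:Z)) + (u1 * k11%:Z + v1 * k21%:Z) *
      (1 - (u2 * k12%:Z + v2 * k22%:Z)) + (u1 * k12%:Z + v1 * k22%:Z)
      * (u2 * k11%:Z + v2 * k21%:Z)
     + (u1 * v2 - v1 * u2) * (k11%:Z * k22%:Z - k21%:Z * k12%:Z) by ring.
have : (p%:Z %| 1%R)%Z.
  rewrite E; move: A2 B1; rewrite !add0r !dvdzE !abszN -!dvdzE => A2 B1.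
  apply: dvdz_add; last exact: dvdz_mull.
  by apply: dvdz_add; [apply: dvdz_add => //; exact: dvdz_mull | exact: dvdz_mulr].
by rewrite dvdz1 /= => /eqP p1; move: (p_pr); rewrite p1.
Qed.
End QuotientExponents.

(** * Divisibility of binomial coefficients *)

Lemma bin3_ffact n : ('C(n, 3) * 6 = n * n.-1 * n.-2)%N.
Proof. by rewrite -[6%N]/(3`!) bin_ffact !ffactnS ffactn0 muln1 mulnA. Qed.

Lemma bin2_ffact n : ('C(n, 2) * 2 = n * n.-1)%N.
Proof. by rewrite -[X in (_ * X)%N]/(2`!) bin_ffact !ffactnS ffactn0 muln1. Qed.

(** Cancelling a number not divisible by [p ^ 2] costs at most one factor [p]; this is applied to 2
    and 6. *)
Lemma pfactor_dvdn_div (p j n x : nat) : prime p -> (0 < n)%N -> ~~ (p ^ 2 %| n)%N ->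
  (p ^ j.+1 %| x * n)%N -> (p ^ j %| x)%N.
Proof.
move=> p_pr n0; rewrite pfactor_dvdn // -ltnNge => ln.
case: (posnP x) => [->|x0]; first by rewrite dvdn0.
by rewrite !pfactor_dvdn ?muln_gt0 ?x0 // lognM //; lia.
Qed.

Lemma prime_sqr_ndvd6 p : prime p -> ~~ (p ^ 2 %| 6)%N.
Proof.
move=> p_pr; apply/negP => p6; have := dvdn_leq (isT : (0 < 6)%N) p6.
have := prime_gt1 p_pr; case: p p_pr p6 => [|[|[|p]]] //; nia.
Qed.

Lemma pfactor_dvdn_bin p j : prime p ->
  (p ^ j %| 'C(p ^ j.+1, 2))%N /\ (p ^ j %| 'C(p ^ j.+1, 3))%N.
Proof.
move=> p_pr; have p6 := prime_sqr_ndvd6 p_pr; split.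
  apply: (@pfactor_dvdn_div _ _ 2) => //; last by rewrite bin2_ffact dvdn_mulr.
  by apply: contra p6 => p2; exact: dvdn_trans p2 _.
by apply: (@pfactor_dvdn_div _ _ 6) => //; rewrite bin3_ffact -mulnA dvdn_mulr.
Qed.

(** The factor 6 clears the denominators of both binomial coefficients. *)
Lemma dvdn_bin_mul6 N : (N %| 'C(6 * N, 2))%N /\ (N %| 'C(6 * N, 3))%N.
Proof.
split.
  rewrite -(dvdn_pmul2r (isT : 0 < 2)%N) bin2_ffact -mulnA mulnCA.
  by rewrite dvdn_mul // -[6%N]/(3 * 2)%N -mulnA dvdn_mull // dvdn_mulr.
rewrite -(dvdn_pmul2r (isT : 0 < 6)%N) bin3_ffact -mulnA -mulnA mulnCA.
by rewrite dvdn_mul // dvdn_mulr.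
Qed.

Lemma dvdzN (m n : int) : (m %| - n)%Z = (m %| n)%Z.
Proof. by rewrite !dvdzE abszN. Qed.

Lemma dvdz_addK (m n k : int) : (m %| n + k)%Z -> (m %| k)%Z -> (m %| n)%Z.
Proof. by move=> mnk mk; rewrite -(addrK k n) dvdz_add // dvdzN. Qed.

(** * Relations between normal forms as congruences *)

Section Level.
Variables (P P' : constants) (M : nat).
Hypothesis M_gt1 : (1 < M)%N.
Local Notation a := (Posz (ca P)).
Local Notation b := (Posz (cb P)).
Local Notation c := (Posz (cc P)).
Local Notation d := (Posz (cd P)).
Local Notation e := (Posz (ce P)).
Local Notation f := (Posz (cf P)).
Local Notation h := (Posz (ch P)).
Local Notation a' := (Posz (ca P')).
Local Notation b' := (Posz (cb P')).
Local Notation c' := (Posz (cc P')).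
Local Notation d' := (Posz (cd P')).
Local Notation e' := (Posz (ce P')).
Local Notation f' := (Posz (cf P')).
Local Notation h' := (Posz (ch P')).
Local Notation elt := (model_elt P M).
Local Notation nfm := (model_nf P M).

Lemma elt_nf k2 k3 k4 k5 : elt (0, k2, k3, k4, k5) = nfm k2%:Z k3 k4 k5.
Proof. exact: mul1g. Qed.

Lemma model_nfM k2 k3 k4 k5 l2 l3 l4 l5 : (nfm k2 k3 k4 k5 * nfm l2 l3 l4 l5)%g
  = nfm (k2 + l2) (k3 + l3) (k4 + l4) (k5 + l5 + h * k3 * l2).
Proof. exact: nf_mul (satisfies_model P M) _ _ _ _ _ _ _ _. Qed.

Lemma model_nfX i j k n :
  (nfm 0 i j k ^+ n)%g = nfm 0 (i * n%:Z) (j * n%:Z) (k * n%:Z).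
Proof. by have := nf_zpow0 (satisfies_model P M) i j k n%:Z. Qed.

(** [nf_swap_g1] lets the factor with [g1] be cancelled; [model_nf_inj] then compares the exponents,
    the last one only up to the factor 2. *)
Lemma conj_rel (k1 k2 l2 : nat) k3 k4 k5 l3 l4 l5 r3 r4 r5 :
  (nfm l2%:Z l3 l4 l5 * elt (k1, k2, k3, k4, k5)
    = elt (k1, k2, k3, k4, k5) * nfm l2%:Z l3 l4 l5 * nfm 0 r3 r4 r5)%g ->
  [/\ (M%:Z %| a * k1%:Z * l2%:Z - r3)%Z,
      (M%:Z %| d * k1%:Z * l3 + conj_g2_exp4 P k1 * l2%:Z - r4)%Z
    & (M%:Z %| 2 * (conj_g2_exp5 P k1 * l2%:Z + h * a * k1%:Z * 'C(l2, 2)%:Z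
        + (e * k1%:Z + d * f * 'C(k1, 2)%:Z) * l3 + f * k1%:Z * l4
        + h * ((l3 + a * k1%:Z * l2%:Z) * k2%:Z - k3 * l2%:Z) - r5))%Z].
Proof.
have -> := nf_swap_g1 (satisfies_model P M) k1 l2 l3 l4 l5 k2%:Z k3 k4 k5.
rewrite -!/(nfm _ _ _ _) -(mulgA (elt _)) => /mulgI.
rewrite model_nfM => /(model_nf_inj M_gt1)[_ E3 E4 E5].
split.
- by move: E3; congr (_ %| _)%Z; ring.
- by move: E4; congr (_ %| _)%Z; ring.
- by move: E5; congr (_ %| _)%Z; ring.
Qed.

(** Each cancellation uses up a factor of the modulus: [rel41] bounds [c53], then [rel31] bounds
    [c43], and [rel41] again bounds [c54]. The last two conclusions combine to force [k21] to vanish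
    modulo a power of [p]. *)
Lemma triangular_step (D k11 k12 k21 k22 : nat)
    (k13 k14 k15 k23 k24 k25 c33 c34 c35 c43 c44 c45 c53 c54 c55 : int) :
  M = (D * cf P' * cd P' * cf P')%N -> (0 < cd P')%N -> (0 < cf P')%N ->
  satisfies P' (elt (k11, k12, k13, k14, k15)) (elt (k21, k22, k23, k24, k25))
    (elt (0, 0, c33, c34, c35)) (elt (0, 0, c43, c44, c45))
    (elt (0, 0, c53, c54, c55)) ->
  [/\ (D%:Z %| c43)%Z, (D%:Z %| c53)%Z, (D%:Z %| c54)%Z, (D%:Z %| d * k21%:Z * c33)%Z
    & (D%:Z %| a * (k11%:Z * k22%:Z - k21%:Z * k12%:Z) - a' * c33)%Z].
Proof.
move=> ME d'_gt0 f'_gt0 yP.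
have d'0 : d' != 0 by rewrite eqz_nat -lt0n.
have f'0 : f' != 0 by rewrite eqz_nat -lt0n.
have MZ : M%:Z = D%:Z * f' * d' * f' by rewrite ME !PoszM.
have sub m n x : (m * n = M%:Z) -> (M%:Z %| x)%Z -> (m %| x)%Z.
  by move=> <-; apply: dvdz_trans; exact: dvdz_mulr.
have heis2 := @heis_elt P M k21 k22 k23 k24 k25.
have heis1 := @heis_elt P M k11 k12 k13 k14 k15.
have heis3 := @heis_elt P M 0 0 c33 c34 c35.
have heis4 := @heis_elt P M 0 0 c43 c44 c45.
have heis5 := @heis_elt P M 0 0 c53 c54 c55.
case: yP => r21 r31 r41 _ r32 _ _ _ _ _.
move: r41; rewrite 2!elt_nf model_nfX => /conj_rel[].
rewrite !mulr0 !sub0r !add0r => A41 B41 _.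
move: r31; rewrite 3!elt_nf !model_nfX model_nfM => /conj_rel[].
rewrite !mulr0 !sub0r ?addr0 => A31 _ _.
move: r32; rewrite (elt_nf _ c33) (elt_nf _ c53) model_nfX => /conj_rel[_].
rewrite !mulr0 addr0 => B32 _.
have c53P : (D%:Z * f' * d' %| c53)%Z.
  by rewrite -(dvdz_mul2r f'0) -MZ -dvdzN.
have c43P : (D%:Z * f' %| c43)%Z.
  rewrite -(dvdz_mul2r d'0); apply: (@dvdz_addK _ _ (c53 * e')).
    by apply: (sub _ f') => //; rewrite -dvdzN.
  exact: dvdz_mulr.
have c54P : (D%:Z %| c54)%Z.
  rewrite -(dvdz_mul2r f'0) -dvdzN.
  apply: (@dvdz_addK _ _ (d * k11%:Z * c43 + 0)).
    by apply: (sub _ (d' * f')); [rewrite MZ !mulrA | rewrite addrC].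
  by rewrite addr0; exact: dvdz_mull.
have DM : (D%:Z %| M%:Z)%Z by rewrite MZ -!mulrA dvdz_mulr.
have DcP : (D%:Z %| c43)%Z by apply: dvdz_trans c43P; exact: dvdz_mulr.
have Dc5P : (D%:Z %| c53)%Z by apply: dvdz_trans c53P; rewrite -mulrA dvdz_mulr.
split=> //.
  apply: (@dvdz_addK _ _ (- (c54 * h'))); first exact: dvdz_trans B32.
  by rewrite dvdzN; exact: dvdz_mulr.
(* Here [y2] may still involve [g1], so [conj_rel] does not apply; the third coordinate of the
   Heisenberg action is compared instead. *)
have := heisM (heisM heis1 heis2)
  (heisM (heisM (heisX0 (ca P') heis3) (heisX0 (cb P') heis4)) (heisX0 (cc P') heis5)).
rewrite -r21 => /(heis_inj (heisM heis2 heis1))[_ _] E3.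
apply: (@dvdz_addK _ _ (- (b' * c43 + c' * c53))); last first.
  by rewrite dvdzN; apply: dvdz_add; exact: dvdz_mull.
apply: dvdz_trans DM _; rewrite -intZp_eq0 //; apply/eqP; move/eqP: E3.
by rewrite -subr_eq0 => /eqP <-; ring.
Qed.

Lemma triangular_relations (k11 k12 k22 : nat)
    (k13 k14 k15 k23 k24 k25 c33 c34 c35 c44 c45 c55 : int) :
  satisfies P' (elt (k11, k12, k13, k14, k15)) (elt (0, k22, k23, k24, k25))
    (elt (0, 0, c33, c34, c35)) (elt (0, 0, 0, c44, c45)) (elt (0, 0, 0, 0, c55)) ->
  [/\ (M%:Z %| a * k11%:Z * k22%:Z - a' * c33)%Z,
      (M%:Z %| d * k11%:Z * k23 + conj_g2_exp4 P k11 * k22%:Z - (a' * c34 + b' * c44))%Z,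
      (M%:Z %| 2 * (conj_g2_exp5 P k11 * k22%:Z + h * a * k11%:Z * 'C(k22, 2)%:Z
        + (e * k11%:Z + d * f * 'C(k11, 2)%:Z) * k23 + f * k11%:Z * k24
        + h * ((k23 + a * k11%:Z * k22%:Z) * k12%:Z - k13 * k22%:Z)
        - (a' * c35 + b' * c45 + c' * c55)))%Z,
      (M%:Z %| d * k11%:Z * c33 - d' * c44)%Z &
      [/\ (M%:Z %| 2 * ((e * k11%:Z + d * f * 'C(k11, 2)%:Z) * c33 + f * k11%:Z * c34
            + h * c33 * k12%:Z - (d' * c45 + e' * c55)))%Z,
          (M%:Z %| 2 * (f * k11%:Z * c44 - f' * c55))%Z &
          (M%:Z %| 2 * (h * k22%:Z * c33 - h' * c55))%Z]].
Proof.
case=> r21 r31 r41 _ r32 _ _ _ _ _.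
move: r21; rewrite (elt_nf k22) (elt_nf _ c33) (elt_nf _ 0 c44) (elt_nf _ 0 0 c55).
rewrite !model_nfX !model_nfM => /conj_rel[A21 B21 C21].
move: r31; rewrite (elt_nf _ c33) (elt_nf _ 0 c44) (elt_nf _ 0 0 c55).
rewrite !model_nfX !model_nfM => /conj_rel[_ B31 C31].
move: r41; rewrite (elt_nf _ 0 c44) (elt_nf _ 0 0 c55).
rewrite !model_nfX => /conj_rel[_ _ C41].
move: r32; rewrite (elt_nf _ c33) (elt_nf _ 0 0 c55).
rewrite !model_nfX => /conj_rel[_ _ C32].
split; last split.
- by move: A21; congr (_ %| _)%Z; ring.
- by move: B21; congr (_ %| _)%Z; ring.
- by move: C21; congr (_ %| _)%Z; ring.
- by move: B31; congr (_ %| _)%Z; ring.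
- by move: C31; congr (_ %| _)%Z; rewrite ?bin0n /=; ring.
- by move: C41; congr (_ %| _)%Z; rewrite ?bin0n /=; ring.
- by move: C32; congr (_ %| _)%Z; rewrite ?bin0n /=; ring.
Qed.

End Level.

(** * Triangular shape of the generators *)

Section Vanish.
Variables (P : constants) (M : nat).
Hypothesis M_gt1 : (1 < M)%N.
Local Notation elt := (model_elt P M).

Lemma elt_dvd1 K k1 k2 k3 k4 k5 : (M %| K)%N -> (M %| 'C(K, 2))%N ->
  (M %| 'C(K, 3))%N -> (K %| k1)%N ->
  elt (k1, k2, k3, k4, k5) = elt (0, k2, k3, k4, k5).
Proof. by move=> K1 K2 K3 Kk; rewrite /model_elt (exp_model_g1_eq1 P M_gt1 K1). Qed.

Lemma elt_dvd2 k1 k2 k3 k4 k5 : (M %| k2)%N ->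
  elt (k1, k2, k3, k4, k5) = elt (k1, 0, k3, k4, k5).
Proof.
move=> k2P; rewrite /model_elt /model_nf /nf.
by rewrite (@zpow_model1 P M M_gt1 _ k2%:Z) ?inE ?eqxx.
Qed.

Lemma elt_dvd3 k1 k2 k3 k4 k5 : (M%:Z %| k3)%Z ->
  elt (k1, k2, k3, k4, k5) = elt (k1, k2, 0, k4, k5).
Proof.
move=> k3P; rewrite /model_elt /model_nf /nf.
by rewrite (@zpow_model1 P M M_gt1 _ k3) ?inE ?eqxx ?orbT.
Qed.

Lemma elt_dvd4 k1 k2 k3 k4 k5 : (M%:Z %| k4)%Z ->
  elt (k1, k2, k3, k4, k5) = elt (k1, k2, k3, 0, k5).
Proof.
move=> k4P; rewrite /model_elt /model_nf /nf.
by rewrite (@zpow_model1 P M M_gt1 _ k4) ?inE ?eqxx ?orbT.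
Qed.

End Vanish.

(* The equations satisfied modulo [F] by the exponents of
   [y1 = g1^k11 g2^k12 g3^k13 ..], [y2 = g2^k22 g3^k23 ..], .., [y5 = g5^c55]
   when the [gi] satisfy the relations of [P] and the [yi] those of [P']. *)
Definition triangular_exponents (P P' : constants) (F : int)
    (k11 k22 : nat) (k12 k13 k23 k24 c33 c34 c35 c44 c45 c55 : int) : Prop :=
  [/\ (F %| (ca P)%:Z * k11%:Z * k22%:Z - (ca P')%:Z * c33)%Z,
      (F %| (cd P)%:Z * k11%:Z * k23 + conj_g2_exp4 P k11 * k22%:Z
        - ((ca P')%:Z * c34 + (cb P')%:Z * c44))%Z,
      (F %| conj_g2_exp5 P k11 * k22%:Z + (ch P)%:Z * (ca P)%:Z * k11%:Z * 'C(k22, 2)%:Z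
        + ((ce P)%:Z * k11%:Z + (cd P)%:Z * (cf P)%:Z * 'C(k11, 2)%:Z) * k23
        + (cf P)%:Z * k11%:Z * k24
        + (ch P)%:Z * ((k23 + (ca P)%:Z * k11%:Z * k22%:Z) * k12 - k13 * k22%:Z)
        - ((ca P')%:Z * c35 + (cb P')%:Z * c45 + (cc P')%:Z * c55))%Z,
      (F %| (cd P)%:Z * k11%:Z * c33 - (cd P')%:Z * c44)%Z &
      [/\ (F %| ((ce P)%:Z * k11%:Z + (cd P)%:Z * (cf P)%:Z * 'C(k11, 2)%:Z) * c33
            + (cf P)%:Z * k11%:Z * c34 + (ch P)%:Z * c33 * k12
            - ((cd P')%:Z * c45 + (ce P')%:Z * c55))%Z,
          (F %| (cf P)%:Z * k11%:Z * c44 - (cf P')%:Z * c55)%Z &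
          (F %| (ch P)%:Z * k22%:Z * c33 - (ch P')%:Z * c55)%Z]].

(* Replacing the modulus by a divisor kills the exponents divisible by it.  This is
   done twice: to bring [y3], [y4], [y5] into [<g3, g4, g5>], then to bring [y2] into
   [<g2, .., g5>], [y4] into [<g4, g5>] and [y5] into [<g5>]. *)
Lemma triangular_extraction (P P' : constants) (p j : nat) : prime p ->
  (0 < ca P)%N -> (0 < cd P)%N -> (0 < ca P')%N -> (0 < cd P')%N -> (0 < cf P')%N ->
  (forall Q, is_quotient P Q -> is_quotient P' Q) ->
  exists (k11 k22 : nat) (k12 k13 k23 k24 c33 c34 c35 c44 c45 c55 : int),
    [/\ ~~ (p %| k11)%N, ~~ (p %| k22)%N &
     triangular_exponents P P' (p ^ j)%N k11 k22 k12 k13 k23 k24 c33 c34 c35 c44 c45 c55].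
Proof.
move=> p_pr a0 d0 a'0 d'0 f'0 PP'.
(* The factor [ca P * cd P] of [D] is cancelled in the proof of [k21P]; of [p ^ j.+2], one [p] is
   lost to binomial coefficients and one to the factor 2. [N2] is the modulus required by
   [triangular_step], and [6 * N2] makes the powers of [g1] vanish modulo [N2]. *)
have [D DE] : {D | D = ca P * cd P * p ^ j.+2}%N by eexists.
have [N2 N2E] : {N2 | N2 = D * cf P' * cd P' * cf P'}%N by eexists.
have p_gt0 := prime_gt0 p_pr; have p_gt1 := prime_gt1 p_pr.
have D_gt0 : (0 < D)%N by rewrite DE 2!muln_gt0 a0 d0 expn_gt0 p_gt0.
have N2_gt0 : (0 < N2)%N by rewrite N2E 3!muln_gt0 D_gt0 f'0 d'0.
have pD : (p ^ j.+2 %| D)%N by rewrite DE dvdn_mull.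
have DN2 : (D %| N2)%N by rewrite N2E -!mulnA dvdn_mulr.
have pN2 : (p %| N2)%N.
  by rewrite (dvdn_trans _ DN2) // (dvdn_trans _ pD) // expnS dvdn_mulr.
have N2_gt1 : (1 < N2)%N by exact: leq_trans p_gt1 (dvdn_leq N2_gt0 pN2).
have M1_gt0 : (0 < 6 * N2)%N by rewrite muln_gt0.
have pM1 : (p %| 6 * N2)%N by rewrite dvdn_mull.
have Ntop_gt1 := quotient_modulus_gt1 p_pr pM1 M1_gt0 a'0 d'0 f'0.
have [k11 [k12 [k21 [k22 [k31 [k32 [k41 [k42 [k51 [k52 [k13 [k14 [k15 [k23 [k24 [k25
  [c33 [c34 [c35 [c43 [c44 [c45 [c53 [c54 [c55 [yP [k31P k41P k51P] [k32P k42P k52P]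
  Delta]]]]]]]]]]]]]]]]]]]]]]]]]] := quotient_exponents p_pr pM1 M1_gt0 a'0 d'0 f'0 PP'.
have N2top : (N2 %| 6 * N2 * ca P' * cd P' * cf P')%N.
  by rewrite -!mulnA mulnCA dvdn_mulr.
move/(satisfies_reduce Ntop_gt1 N2_gt1 N2top): yP.
have [C2 C3] := dvdn_bin_mul6 N2.
have K1 : (N2 %| 6 * N2)%N by rewrite dvdn_mull.
rewrite (elt_dvd1 P N2_gt1 k32 c33 c34 c35 K1 C2 C3 k31P).
rewrite (elt_dvd1 P N2_gt1 k42 c43 c44 c45 K1 C2 C3 k41P).
rewrite (elt_dvd1 P N2_gt1 k52 c53 c54 c55 K1 C2 C3 k51P).
rewrite (elt_dvd2 P N2_gt1 0 c33 c34 c35 (dvdn_trans K1 k32P)).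
rewrite (elt_dvd2 P N2_gt1 0 c43 c44 c45 (dvdn_trans K1 k42P)).
rewrite (elt_dvd2 P N2_gt1 0 c53 c54 c55 (dvdn_trans K1 k52P)) => yP2.
have [c43P c53P c54P dP aP] := triangular_step N2_gt1 N2E d'0 f'0 yP2.
have pDelta : coprimez (p ^ j.+2)%N (k11%:Z * k22%:Z - k21%:Z * k12%:Z).
  rewrite coprimezE /= coprime_pexpl // prime_coprime //.
(* By [dP] and [aP], [D] divides the product of [ca P], [cd P], [k21] and the determinant, and the
   latter is prime to [p]. *)
have k21P : (p ^ j.+2 %| k21)%N.
  have ad0 : (ca P)%:Z * (cd P)%:Z != 0.
    by rewrite mulf_neq0 // eqz_nat -lt0n.
  suff : ((p ^ j.+2)%N%:Z %| k21%:Z)%Z by [].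
  rewrite -(Gauss_dvdzl _ pDelta) -(dvdz_mul2r ad0).
  rewrite (_ : (p ^ j.+2)%N%:Z * _ = D%:Z); last by rewrite DE !PoszM; ring.
  rewrite (_ : _ * _ = (cd P)%:Z * k21%:Z * ((ca P)%:Z * (k11%:Z * k22%:Z
     - k21%:Z * k12%:Z) - (ca P')%:Z * c33) + (ca P')%:Z * ((cd P)%:Z * k21%:Z * c33));
    last by ring.
  by apply: dvdz_add; exact: dvdz_mull.
have p_k1122 : ~~ (p %| k11 * k22)%N.
  apply: contra Delta => pk.
  apply: dvdz_add; first by rewrite -PoszM.
  rewrite dvdzN; apply: dvdz_mulr; rewrite dvdzE /=.
  by apply: dvdn_trans k21P; rewrite expnS dvdn_mulr.
move: p_k1122; rewrite Euclid_dvdM // negb_or => /andP[pk11 pk22].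
have N_gt1 : (1 < p ^ j.+1)%N by rewrite -{1}(expn0 p) ltn_exp2l.
have ND : (p ^ j.+1 %| D)%N by rewrite (dvdn_trans _ pD) // dvdn_exp2l.
have NN2 := dvdn_trans ND DN2.
have NDz : ((p ^ j.+1)%N%:Z %| D%:Z)%Z by [].
have [B2 B3] := pfactor_dvdn_bin j.+1 p_pr.
have K2 : (p ^ j.+1 %| p ^ j.+2)%N by rewrite dvdn_exp2l.
move/(satisfies_reduce N2_gt1 N_gt1 NN2): yP2.
rewrite (elt_dvd1 P N_gt1 k22 k23 k24 k25 K2 B2 B3 k21P).
rewrite (elt_dvd3 P N_gt1 0 0 c44 c45 (dvdz_trans NDz c43P)).
rewrite (elt_dvd3 P N_gt1 0 0 c54 c55 (dvdz_trans NDz c53P)).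
rewrite (elt_dvd4 P N_gt1 0 0 0 c55 (dvdz_trans NDz c54P)).
case/(triangular_relations N_gt1) => A21 B21 C21 B31 [C31 C41 C32].
have Nj : ((p ^ j)%N%:Z %| (p ^ j.+1)%N%:Z)%Z by rewrite dvdzE /= dvdn_exp2l.
have half x : ((p ^ j.+1)%N%:Z %| 2 * x)%Z -> ((p ^ j)%N%:Z %| x)%Z.
  rewrite !dvdzE /= abszM mulnC; apply: pfactor_dvdn_div => //.
  by apply: contra (prime_sqr_ndvd6 p_pr) => p2; exact: dvdn_trans p2 _.
exists k11, k22, k12%:Z, k13, k23, k24, c33, c34, c35, c44, c45, c55.
by split=> //; split; last split; try exact: half; exact: dvdz_trans Nj _.
Qed.

(** * From triangular exponents to the three equations *)

(** The hypotheses are the [g4] and [g5] exponents of [rel21] and the [g5] exponents of [rel31],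
    with the values of [c33], [c44], [c55] substituted. After dividing every exponent by a suitable
    unit, [be] cancels and [al] plays the role of [u]. *)
Lemma solvable_of_triangular (R : comUnitRingType) (P P' : constants)
    (k11 k22 : nat) (k12 k13 k23 k24 c34 c35 c45 : R) :
  let al : R := k11%:R in let be : R := k22%:R in
  let a : R := (ca P)%:R in let b : R := (cb P)%:R in let c : R := (cc P)%:R in
  let d : R := (cd P)%:R in let e : R := (ce P)%:R in let f : R := (cf P)%:R in
  let h : R := (ch P)%:R in
  al \is a GRing.unit -> be \is a GRing.unit ->
  d * al * k23 + (b * al + a * d * 'C(k11, 2)%:R) * be
    = a * c34 + (cb P')%:R * (al ^+ 2 * be) ->
  (c * al + (a * e + b * f) * 'C(k11, 2)%:R + a * d * f * 'C(k11, 3)%:R) * be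
    + h * a * al * 'C(k22, 2)%:R + (e * al + d * f * 'C(k11, 2)%:R) * k23
    + f * al * k24 + h * ((k23 + a * al * be) * k12 - k13 * be)
    = a * c35 + (cb P')%:R * c45 + (cc P')%:R * (al ^+ 3 * be) ->
  (e * al + d * f * 'C(k11, 2)%:R) * (al * be) + f * al * c34 + h * (al * be) * k12
    = d * c45 + (ce P')%:R * (al ^+ 3 * be) ->
  solvable_in R P P'.
Proof.
move=> al be a b c d e f h alU beU.
have scale (x t : R) : t \is a GRing.unit -> {y | x = y * t}.
  by move=> tU; exists (x / t); rewrite divrK.
have abU : al * be \is a GRing.unit by rewrite unitrM alU.
have aabU : al ^+ 2 * be \is a GRing.unit by rewrite unitrM unitrX.
have [k2 ->] := scale 'C(k11, 2)%:R _ alU.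
have [k3 ->] := scale 'C(k11, 3)%:R _ alU.
have [kb ->] := scale 'C(k22, 2)%:R _ beU.
have [v ->] := scale k23 _ beU.
have [y ->] := scale k12 _ alU.
have [q ->] := scale k24 _ beU.
have [r ->] := scale k13 _ alU.
have [l ->] := scale c35 _ abU.
have [w1 ->] := scale c34 _ abU.
have [x1 ->] := scale c45 _ aabU.
move=> E4 E E5.
have [a1 aE] := dvdnP (dvdn_trans (dvdn_gcdl _ (ch P)) (dvdn_gcdl (ca P) (cf P))).
have [f1 fE] := dvdnP (dvdn_trans (dvdn_gcdl _ (ch P)) (dvdn_gcdr (ca P) (cf P))).
have [h1 hE] := dvdnP (dvdn_gcdr (gcdn (ca P) (cf P)) (ch P)).
have {E4} E4 : (cb P')%:R * al = b - a * (w1 - d * k2) + d * v.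
  by apply: (mulrI abU); move/eqP: E4; rewrite -subr_eq0 => /eqP E4;
     apply/eqP; rewrite -subr_eq0 -(oppr0 R) -E4; apply/eqP; ring.
have {E5} E5 : (ce P')%:R * al
    = e + f * (w1 - d * k2) + d * (2%:R * f * k2 - x1) + h * y.
  by apply: (mulrI aabU); move/eqP: E5; rewrite -subr_eq0 => /eqP E5;
     apply/eqP; rewrite -subr_eq0 -(oppr0 R) -E5; apply/eqP; ring.
(* The shifts by multiples of [k2] absorb the terms with the binomial coefficient of [k11]. What is
   left in the third equation consists of multiples of [a], [f] and [h], hence of their gcd, and
   goes into the last witness. *)
exists al => //; exists v, (w1 - d * k2), (2%:R * f * k2 - x1), y.
pose W := w1 - d * k2; pose X := 2%:R * f * k2 - x1.
exists (a1%:R * (e * k2 + d * f * k3 + h * kb + h * al * y - l + 2%:R * f * k2 * W - W * X)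
  + f1%:R * (q - b * k2 - d * k2 * v) + h1%:R * (v * y - r)).
split=> //.
apply: (mulrI abU).
move: aE fE hE; set g := gcdn _ _ => aE fE hE.
rewrite -/a -/b -/c -/d -/e -/f -/h.
have {}aE : a1%:R * g%:R = a by rewrite -natrM -aE.
have {}fE : f1%:R * g%:R = f by rewrite -natrM -fE.
have {}hE : h1%:R * g%:R = h by rewrite -natrM -hE.
have gE A B C : g%:R * (a1%:R * A + f1%:R * B + h1%:R * C) = a * A + f * B + h * C.
  by rewrite -aE -fE -hE; ring.
rewrite gE.
have bE : (cb P')%:R * (x1 * (al ^+ 2 * be)) = x1 * al * be * ((cb P')%:R * al) by ring.
rewrite bE E4 in E.
transitivity ((cc P')%:R * (al ^+ 3 * be)); first by ring.
move/eqP: E; rewrite -subr_eq0 => /eqP E; apply/eqP.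
by rewrite -subr_eq0 -(oppr0 R) -E /W /X; apply/eqP; ring.
Qed.

(** * Leading entries and solutions modulo prime powers *)

Lemma dvdn_prime_powers m n :
  (forall p j, prime p -> (p ^ j %| m)%N -> (p ^ j %| n)%N) -> (m %| n)%N.
Proof.
move=> mn; case: (posnP n) => [->|n_gt0]; first exact: dvdn0.
case: (posnP m) => [m0|m_gt0].
  (* The case [m = 0] matters because [ch] may vanish; then [2 ^ n] would divide the positive
     [n]. *)
  have := mn 2 n isT; rewrite m0 dvdn0 => /(_ isT)/(dvdn_leq n_gt0).
  by rewrite leqNgt ltn_expl.
apply/dvdn_partP => // p pm; rewrite p_part.
have p_pr : prime p by move: pm; rewrite mem_primes => /andP[].
by apply: mn => //; rewrite pfactor_dvdn.
Qed.

Lemma pfactor_dvdz_cancel p j a (x : int) : prime p -> (0 < a)%N ->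
  ((p ^ (logn p a + j))%N%:Z %| a%:Z * x)%Z -> ((p ^ j)%N%:Z %| x)%Z.
Proof.
move=> p_pr a_gt0; rewrite !dvdzE abszM /=.
case: (posnP `|x|%N) => [->|x0]; first by rewrite dvdn0.
by rewrite !pfactor_dvdn ?muln_gt0 ?a_gt0 ?x0 // lognM // leq_add2l.
Qed.

Lemma dvdz_congr_unit (p : nat) (x y : int) : (p%:Z %| x - y)%Z ->
  ~~ (p%:Z %| x)%Z -> ~~ (p%:Z %| y)%Z.
Proof. by move=> xy; apply: contra => py; rewrite -(subrK y x) dvdz_add. Qed.

Lemma prime_pow_Gauss (p j : nat) (x y : int) : prime p -> ~~ (p%:Z %| x)%Z ->
  ((p ^ j)%N%:Z %| x * y)%Z -> ((p ^ j)%N%:Z %| y)%Z.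
Proof.
move=> p_pr px; rewrite Gauss_dvdzr // coprimezE /=.
by case: j => [|j]; rewrite ?coprime1n // coprime_pexpl // prime_coprime.
Qed.

Lemma prime_ndvdzM (p : nat) (x y : int) : prime p -> ~~ (p%:Z %| x)%Z ->
  ~~ (p%:Z %| y)%Z -> ~~ (p%:Z %| x * y)%Z.
Proof. by move=> p_pr; rewrite !dvdzE abszM /= Euclid_dvdM // negb_or => -> ->. Qed.

Section Leading.
Variables (P P' : constants).
Hypotheses (a_gt0 : (0 < ca P)%N) (d_gt0 : (0 < cd P)%N) (f_gt0 : (0 < cf P)%N).
Hypotheses (a'_gt0 : (0 < ca P')%N) (d'_gt0 : (0 < cd P')%N) (f'_gt0 : (0 < cf P')%N).
Hypothesis PP' : forall Q, is_quotient P Q -> is_quotient P' Q.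

Lemma dvdz_weaken p i j x : (i <= j)%N ->
  ((p ^ j)%N%:Z %| x)%Z -> ((p ^ i)%N%:Z %| x)%Z.
Proof. by move=> ij; apply: dvdz_trans; rewrite dvdzE /= dvdn_exp2l. Qed.

Lemma leading_units p j : prime p ->
  exists (k11 k22 c33 c44 c55 : int),
   [/\ ~~ (p%:Z %| k11)%Z, ~~ (p%:Z %| k22)%Z &
    [/\ ((p ^ j)%N%:Z %| (ca P)%:Z * (k11 * k22) - (ca P')%:Z * c33)%Z,
        ((p ^ j)%N%:Z %| (cd P)%:Z * (k11 * c33) - (cd P')%:Z * c44)%Z,
        ((p ^ j)%N%:Z %| (cf P)%:Z * (k11 * c44) - (cf P')%:Z * c55)%Z &
        ((p ^ j)%N%:Z %| (ch P)%:Z * (k22 * c33) - (ch P')%:Z * c55)%Z]].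
Proof.
move=> p_pr; have [k11 [k22 [k12 [k13 [k23 [k24 [c33 [c34 [c35 [c44 [c45 [c55 [p1 p2]
  [A21 _ _ B31 [_ C41 C32]]]]]]]]]]]]]] :=
  triangular_extraction j p_pr a_gt0 d_gt0 a'_gt0 d'_gt0 f'_gt0 PP'.
by exists k11, k22, c33, c44, c55; split=> //; rewrite !mulrA.
Qed.

Lemma dvdz_sub_l (m n k : int) : (m %| n - k)%Z -> (m %| k)%Z -> (m %| n)%Z.
Proof. by move=> mnk mk; apply: (@dvdz_addK _ _ (- k)); rewrite ?dvdzN. Qed.

(** If [p ^ j] divides [ca P'], it divides [ca P * k11 * k22], where [k11] and [k22] are prime to
    [p]. The opposite divisibility is obtained later by exchanging [P] and [P']. *)
Lemma ca_dvd : (ca P' %| ca P)%N.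
Proof.
apply: dvdn_prime_powers => p j p_pr pj.
have [k11 [k22 [c33 [c44 [c55 [p1 p2 [A _ _ _]]]]]]] := leading_units j p_pr.
have {}A : ((p ^ j)%N%:Z %| (k11 * k22) * (ca P)%:Z)%Z.
  by rewrite mulrC; apply: dvdz_sub_l A _; apply: dvdz_mulr.
by have := prime_pow_Gauss p_pr (prime_ndvdzM p_pr p1 p2) A.
Qed.

Hypothesis Ea : ca P' = ca P.

(** With [ca] in common, the first congruence cancels to one between [k11 * k22] and [c33] modulo
    [p], so [c33] is prime to [p] as well; [J] makes up for the [p]-part of [ca P]. *)
Lemma leading_units_a p j : prime p -> let J := (logn p (ca P) + j.+1)%N in
  exists (k11 k22 c33 c44 c55 : int),
   [/\ ~~ (p%:Z %| k11)%Z, ~~ (p%:Z %| k22)%Z, ~~ (p%:Z %| c33)%Z &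
    [/\ ((p ^ j)%N%:Z %| (cd P)%:Z * (k11 * c33) - (cd P')%:Z * c44)%Z,
        ((p ^ j)%N%:Z %| (cf P)%:Z * (k11 * c44) - (cf P')%:Z * c55)%Z &
        ((p ^ j)%N%:Z %| (ch P)%:Z * (k22 * c33) - (ch P')%:Z * c55)%Z]].
Proof.
move=> p_pr J.
have [k11 [k22 [c33 [c44 [c55 [p1 p2 [A B C D]]]]]]] := leading_units J p_pr.
have jJ : (j <= J)%N by exact: leq_trans (leqnSn j) (leq_addl _ _).
exists k11, k22, c33, c44, c55; split=> //; last by split; exact: dvdz_weaken jJ _.
move: A; rewrite Ea -mulrBr => /(pfactor_dvdz_cancel p_pr a_gt0).
move/(dvdz_weaken (ltn0Sn _)); rewrite expn1 => A.
exact: dvdz_congr_unit A (prime_ndvdzM p_pr p1 p2).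
Qed.

Lemma cd_dvd : (cd P' %| cd P)%N.
Proof.
apply: dvdn_prime_powers => p j p_pr pj.
have [k11 [k22 [c33 [c44 [c55 [p1 p2 p3 [A _ _]]]]]]] := leading_units_a j p_pr.
have {}A : ((p ^ j)%N%:Z %| (k11 * c33) * (cd P)%:Z)%Z.
  by rewrite mulrC; apply: dvdz_sub_l A _; apply: dvdz_mulr.
by have := prime_pow_Gauss p_pr (prime_ndvdzM p_pr p1 p3) A.
Qed.

Hypothesis Ed : cd P' = cd P.

Lemma cf_dvd : (cf P' %| cf P)%N.
Proof.
apply: dvdn_prime_powers => p j p_pr pj.
have [k11 [k22 [c33 [c44 [c55 [p1 p2 p3 [A B _]]]]]]] :=
  leading_units_a (logn p (cd P) + j.+1) p_pr.
(* With [cd] in common, [c44] is congruent to [k11 * c33] modulo [p]. *)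
have p4 : ~~ (p%:Z %| c44)%Z.
  move: A; rewrite Ed -mulrBr => /(pfactor_dvdz_cancel p_pr d_gt0).
  move/(dvdz_weaken (ltn0Sn _)); rewrite expn1 => A.
  exact: dvdz_congr_unit A (prime_ndvdzM p_pr p1 p3).
have {}B : ((p ^ j)%N%:Z %| (k11 * c44) * (cf P)%:Z)%Z.
  rewrite mulrC; apply: dvdz_sub_l (dvdz_weaken _ B) _.
    exact: leq_trans (leqnSn j) (leq_addl _ _).
  exact: dvdz_mulr.
by have := prime_pow_Gauss p_pr (prime_ndvdzM p_pr p1 p4) B.
Qed.

Lemma ch_dvd : (ch P' %| ch P)%N.
Proof.
apply: dvdn_prime_powers => p j p_pr pj.
have [k11 [k22 [c33 [c44 [c55 [p1 p2 p3 [_ _ C]]]]]]] := leading_units_a j p_pr.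
have {}C : ((p ^ j)%N%:Z %| (k22 * c33) * (ch P)%:Z)%Z.
  by rewrite mulrC; apply: dvdz_sub_l C _; apply: dvdz_mulr.
by have := prime_pow_Gauss p_pr (prime_ndvdzM p_pr p2 p3) C.
Qed.

Hypothesis Ef : cf P' = cf P.

Lemma solvable_prime_power p n : prime p -> solvable_in 'Z_(p ^ n.+1) P P'.
Proof.
move=> p_pr; pose s := (logn p (cd P) + n.+1)%N.
have N_gt1 : (1 < p ^ n.+1)%N by rewrite -{1}(expn0 p) ltn_exp2l // prime_gt1.
(* The exponent leaves room for cancelling [ca P], [cd P] and [cf P] in turn, which determines
   [c33], [c44] and [c55] modulo [p ^ n.+1]. *)
have [k11 [k22 [k12 [k13 [k23 [k24 [c33 [c34 [c35 [c44 [c45 [c55 [p1 p2]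
  [A21 B21 C21 B31 [C31 C41 C32]]]]]]]]]]]]]] :=
  triangular_extraction (logn p (ca P) + (logn p (cd P) + (logn p (cf P) + n.+1)))
    p_pr a_gt0 d_gt0 a'_gt0 d'_gt0 f'_gt0 PP'.
set J := (_ + (_ + _))%N in A21 B21 C21 B31 C31 C41 C32.
have toR x y : ((p ^ J)%N%:Z %| x - y)%Z -> x%:~R = y%:~R :> 'Z_(p ^ n.+1).
  move=> xy; apply/eqP; rewrite eq_intZp //; apply: dvdz_weaken xy.
  by rewrite /J !addnA leq_addl.
have toRc a x y : (0 < a)%N -> (logn p a + n.+1 <= J)%N ->
    ((p ^ J)%N%:Z %| a%:Z * x - a%:Z * y)%Z -> x%:~R = y%:~R :> 'Z_(p ^ n.+1).
  move=> a0 aJ; rewrite -mulrBr => /(dvdz_weaken aJ)/(pfactor_dvdz_cancel p_pr a0) xy.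
  by apply/eqP; rewrite eq_intZp.
rewrite Ea in A21 B21 C21; rewrite Ed in B31 C31; rewrite Ef in C41.
have {A21} E33 : c33%:~R = k11%:R * k22%:R :> 'Z_(p ^ n.+1).
  have := toRc (ca P) (k11%:Z * k22%:Z) c33 a_gt0 _ _; rewrite intrM -!pmulrn => <- //.
    by rewrite /J leq_add2l !addnA leq_addl.
  by rewrite mulrA.
have {B31} E44 : c44%:~R = k11%:R ^+ 2 * k22%:R :> 'Z_(p ^ n.+1).
  have := toRc (cd P) (k11%:Z * c33) c44 d_gt0 _ _.
  rewrite intrM -!pmulrn E33 => <- //; first by rewrite expr2 mulrA.
    by rewrite /J addnCA leq_add2l !addnA leq_addl.
  by rewrite mulrA.
have {C41} E55 : c55%:~R = k11%:R ^+ 3 * k22%:R :> 'Z_(p ^ n.+1).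
  have := toRc (cf P) (k11%:Z * c44) c55 f_gt0 _ _.
  rewrite intrM -!pmulrn E44 => <- //; first by rewrite exprS mulrA.
    by rewrite /J addnA leq_addl.
  by rewrite mulrA.
move: (toR _ _ B21) (toR _ _ C21) (toR _ _ C31) => {toR toRc B21 C21 C31 C32}.
rewrite /conj_g2_exp4 /conj_g2_exp5 => E4 E E5.
have unit k : ~~ (p %| k)%N -> (k%:R : 'Z_(p ^ n.+1)) \is a GRing.unit.
  by move=> pk; rewrite unitZpE // coprimeXl // prime_coprime.
apply: (@solvable_of_triangular _ P P' k11 k22 k12%:~R k13%:~R k23%:~R k24%:~R
  c34%:~R c35%:~R c45%:~R).
- exact: unit.
- exact: unit.
- by rewrite -E44; move/eqP: E4; rewrite -subr_eq0 => /eqP E4; apply/eqP;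
    rewrite -subr_eq0 -E4; apply/eqP; ring.
- by rewrite -E55; move/eqP: E; rewrite -subr_eq0 => /eqP E; apply/eqP;
    rewrite -subr_eq0 -E; apply/eqP; ring.
- by rewrite -E33 -E55; move/eqP: E5; rewrite -subr_eq0 => /eqP E5; apply/eqP;
    rewrite -subr_eq0 -E5; apply/eqP; ring.
Qed.

End Leading.

(** * Change of ring *)

Local Notation lead_gcd P := (gcdn (gcdn (ca P) (cf P)) (ch P)).

Lemma solvable_in_rmorph (R S : comUnitRingType) (phi : {rmorphism R -> S}) P P' :
  solvable_in R P P' -> solvable_in S P P'.
Proof.
case=> u uU [v [w [x [y [z [E4 E5 E]]]]]].
exists (phi u); first exact: rmorph_unit.
exists (phi v), (phi w), (phi x), (phi y), (phi z).
move/(congr1 phi): E4; move/(congr1 phi): E5; move/(congr1 phi): E.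
rewrite !(rmorphD, rmorphB, rmorphN, rmorphM, rmorphXn, rmorph_nat) => E E5 E4.
by rewrite E4 E5 E.
Qed.

(** Given a solution from [s] to [t], this yields the one from [t] to [s] needed for the reverse
    inclusion of finite quotients. *)
Lemma solvable_in_sym (R : comUnitRingType) P P' : same_lead P P' ->
  solvable_in R P P' -> solvable_in R P' P.
Proof.
case=> Ea Ed Ef Eh [u uU [v [w [x [y [z [E4 E5 E]]]]]]].
have [a1 aE] := dvdnP (dvdn_trans (dvdn_gcdl _ (ch P)) (dvdn_gcdl (ca P) (cf P))).
have [f1 fE] := dvdnP (dvdn_trans (dvdn_gcdl _ (ch P)) (dvdn_gcdr (ca P) (cf P))).
have [h1 hE] := dvdnP (dvdn_gcdr (gcdn (ca P) (cf P)) (ch P)).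
rewrite /solvable_in Ea Ed Ef Eh.
move: aE fE hE E; set g := gcdn _ _ => aE fE hE E.
have {}aE : (ca P)%:R = a1%:R * g%:R :> R by rewrite -natrM -aE.
have {}fE : (cf P)%:R = f1%:R * g%:R :> R by rewrite -natrM -fE.
have {}hE : (ch P)%:R = h1%:R * g%:R :> R by rewrite -natrM -hE.
have E4' : (cb P)%:R = (cb P')%:R * u + (ca P)%:R * w - (cd P)%:R * v.
  by rewrite E4; ring.
have E5' : (ce P)%:R = (ce P')%:R * u - (cf P)%:R * w - (cd P)%:R * x - (ch P)%:R * y.
  by rewrite E5; ring.
have E' : (cc P)%:R = (cc P')%:R * u ^+ 2 - ((ce P)%:R * v + (cb P)%:R * x
  + (cd P)%:R * v * x + g%:R * z) by rewrite E; ring.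
have [v' vE] : {v' | v = v' * u} by exists (v / u); rewrite divrK.
have [w' wE] : {w' | w = w' * u} by exists (w / u); rewrite divrK.
have [x' xE] : {x' | x = x' * u} by exists (x / u); rewrite divrK.
have [y' yE] : {y' | y = y' * u} by exists (y / u); rewrite divrK.
have [z' zE] : {z' | z = z' * u ^+ 2} by exists (z / u ^+ 2); rewrite divrK ?unitrX.
exists u^-1; first by rewrite unitrV.
(* Inverting the linear equations negates the unknowns and divides them by [u]. Replacing [e] and
   [b] in the third equation creates products with [ca P], [cf P] and [ch P], which are multiples of
   [g] and correct [z]. *)
exists (- v'), (- w'), (- x'), (- y').
exists (- z' + f1%:R * w' * v' + h1%:R * y' * v' - a1%:R * w' * x').
split.
- by apply: (mulIr uU); rewrite divrK // E4' wE vE; ring.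
- by apply: (mulIr uU); rewrite divrK // E5' wE xE yE; ring.
- apply: (mulIr (unitrX 2 uU)); rewrite exprVn divrK ?unitrX // E' E5' E4'.
  by rewrite zE wE vE xE yE aE fE hE; ring.
Qed.

(** * Integer solutions and the Chinese remainder theorem *)

Definition defect124 (P P' : constants) (u v w : int) : int :=
  (cb P')%:Z * u - ((cb P)%:Z - (ca P)%:Z * w + (cd P)%:Z * v).
Definition defect135 (P P' : constants) (u w x y : int) : int :=
  (ce P')%:Z * u - ((ce P)%:Z + (cf P)%:Z * w + (cd P)%:Z * x + (ch P)%:Z * y).
Definition defect125 (P P' : constants) (u v x z : int) : int :=
  (cc P')%:Z * u ^+ 2 - ((cc P)%:Z + (ce P)%:Z * v + (cb P)%:Z * x
    + (cd P)%:Z * v * x + (lead_gcd P)%:Z * z).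

Definition solution_mod (P P' : constants) (q u v w x y z : int) : Prop :=
  [/\ (q %| defect124 P P' u v w)%Z, (q %| defect135 P P' u w x y)%Z
    & (q %| defect125 P P' u v x z)%Z].

Lemma solution_modP (P P' : constants) (M : nat) (u v w x y z : int) : (1 < M)%N ->
  solution_mod P P' M u v w x y z <->
  [/\ (cb P')%:R * u%:~R = (cb P)%:R - (ca P)%:R * w%:~R + (cd P)%:R * v%:~R :> 'Z_M,
      (ce P')%:R * u%:~R
         = (ce P)%:R + (cf P)%:R * w%:~R + (cd P)%:R * x%:~R + (ch P)%:R * y%:~R :> 'Z_M
     & (cc P')%:R * u%:~R ^+ 2
         = (cc P)%:R + (ce P)%:R * v%:~R + (cb P)%:R * x%:~R + (cd P)%:R * v%:~R * x%:~R
           + (lead_gcd P)%:R * z%:~R :> 'Z_M].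
Proof.
move=> M_gt1; rewrite /solution_mod /defect124 /defect135 /defect125 -!eq_intZp //.
set g := gcdn _ _; rewrite !(intrD, intrM, rmorphXn, intrB, mulrNz) /= -!pmulrn.
by split=> -[/eqP E4 /eqP E5 /eqP E]; split=> //; apply/eqP.
Qed.

Lemma solvable_in_lift P P' (M : nat) : (1 < M)%N -> solvable_in 'Z_M P P' ->
  exists u v w x y z : int, coprimez M u /\ solution_mod P P' M u v w x y z.
Proof.
move=> M_gt1 [u uU [v [w [x [y [z E]]]]]].
have lift (t : 'Z_M) : t = (val t)%:Z%:~R by rewrite -pmulrn natr_Zp.
rewrite (lift u) (lift v) (lift w) (lift x) (lift y) (lift z) in E.
do 6!eexists; split; last by apply/solution_modP => //; exact: E.
by rewrite coprimezE /= -unitZpE // natr_Zp.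
Qed.

Lemma solution_mod_solvable P P' (M : nat) u v w x y z : (1 < M)%N -> coprimez M u ->
  solution_mod P P' M u v w x y z -> solvable_in 'Z_M P P'.
Proof.
move=> M_gt1 Mu /(solution_modP _ _ _ _ _ _ _ _ M_gt1) E.
exists u%:~R; last by exists v%:~R, w%:~R, x%:~R, y%:~R, z%:~R.
case: u Mu {E} => n; rewrite coprimezE /= => Mn; first by rewrite -pmulrn unitZpE.
by rewrite NegzE mulrNz unitrN -pmulrn unitZpE.
Qed.

Lemma solution_mod_congr P P' (q u v w x y z u' v' w' x' y' z' : int) :
  (q %| u - u')%Z -> (q %| v - v')%Z -> (q %| w - w')%Z -> (q %| x - x')%Z ->
  (q %| y - y')%Z -> (q %| z - z')%Z ->
  solution_mod P P' q u' v' w' x' y' z' -> solution_mod P P' q u v w x y z.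
Proof.
move=> qu qv qw qx qy qz [q4 q5 q2].
have add m n : (q %| m)%Z -> (q %| n)%Z -> (q %| m + n)%Z by exact: rpredD.
have mul m n : (q %| m)%Z -> (q %| n * m)%Z by exact: dvdz_mull.
split.
- rewrite (_ : defect124 _ _ _ _ _ = defect124 P P' u' v' w' + (cb P')%:Z * (u - u')
    + (ca P)%:Z * (w - w') + (- (cd P)%:Z) * (v - v')); last by rewrite /defect124; ring.
  exact: (add _ _ (add _ _ (add _ _ q4 (mul _ _ qu)) (mul _ _ qw)) (mul _ _ qv)).
- rewrite (_ : defect135 _ _ _ _ _ _ = defect135 P P' u' w' x' y' + (ce P')%:Z * (u - u')
    + (- (cf P)%:Z) * (w - w') + (- (cd P)%:Z) * (x - x') + (- (ch P)%:Z) * (y - y'));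
    last by rewrite /defect135; ring.
  exact: (add _ _ (add _ _ (add _ _ (add _ _ q5 (mul _ _ qu)) (mul _ _ qw))
    (mul _ _ qx)) (mul _ _ qy)).
- rewrite (_ : defect125 _ _ _ _ _ _ = defect125 P P' u' v' x' z'
    + (cc P')%:Z * (u + u') * (u - u')
    + (- ((ce P)%:Z + (cd P)%:Z * x)) * (v - v')
    + (- ((cb P)%:Z + (cd P)%:Z * v')) * (x - x') + (- (lead_gcd P)%:Z) * (z - z'));
    last by rewrite /defect125; ring.
  exact: (add _ _ (add _ _ (add _ _ (add _ _ q2 (mul _ _ qu)) (mul _ _ qv))
    (mul _ _ qx)) (mul _ _ qz)).
Qed.

Lemma solvable_in_coprime P P' (m n : nat) : (1 < m)%N -> (1 < n)%N -> coprime m n ->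
  solvable_in 'Z_m P P' -> solvable_in 'Z_n P P' -> solvable_in 'Z_(m * n) P P'.
Proof.
move=> m_gt1 n_gt1 mn.
move=> /(solvable_in_lift m_gt1)[u1 [v1 [w1 [x1 [y1 [z1 [c1 S1]]]]]]].
move=> /(solvable_in_lift n_gt1)[u2 [v2 [w2 [x2 [y2 [z2 [c2 S2]]]]]]].
have mnz : coprimez m n by rewrite coprimezE.
pose t (k l : int) := zchinese m n k l.
have tm k l : (m %| t k l - k)%Z by rewrite -eqz_mod_dvd zchinese_modl.
have tn k l : (n %| t k l - l)%Z by rewrite -eqz_mod_dvd zchinese_modr.
have mn_gt1 : (1 < m * n)%N by rewrite (leq_trans m_gt1) // leq_pmulr // ltnW.
apply: (@solution_mod_solvable _ _ _ (t u1 u2) (t v1 v2) (t w1 w2) (t x1 x2)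
  (t y1 y2) (t z1 z2) mn_gt1).
  rewrite PoszM coprimezMl; apply/andP; split.
    rewrite /coprimez -gcdz_modr (eqP (_ : t u1 u2 == u1 %[mod m])%Z).
      by rewrite gcdz_modr.
    by rewrite eqz_mod_dvd.
  rewrite /coprimez -gcdz_modr (eqP (_ : t u1 u2 == u2 %[mod n])%Z).
    by rewrite gcdz_modr.
  by rewrite eqz_mod_dvd.
have [A1 B1 C1] : solution_mod P P' m (t u1 u2) (t v1 v2) (t w1 w2) (t x1 x2)
  (t y1 y2) (t z1 z2) by exact: solution_mod_congr S1.
have [A2 B2 C2] : solution_mod P P' n (t u1 u2) (t v1 v2) (t w1 w2) (t x1 x2)
  (t y1 y2) (t z1 z2) by exact: solution_mod_congr S2.
by split; rewrite PoszM Gauss_dvdz // ?A1 ?B1 ?C1.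
Qed.

(** Strong induction on [M], splitting off the full power of its smallest prime divisor. *)
Lemma solvable_in_all P P' : (forall p n, prime p -> solvable_in 'Z_(p ^ n.+1) P P') ->
  forall M, (1 < M)%N -> solvable_in 'Z_M P P'.
Proof.
move=> sol M; elim/ltn_ind: M => M IH M_gt1.
have p_pr := pdiv_prime M_gt1; set p := pdiv M in p_pr.
have M_gt0 : (0 < M)%N by exact: ltnW.
have [m pm ME] := pfactor_coprime p_pr M_gt0.
have : (0 < logn p M)%N by rewrite logn_gt0 mem_primes p_pr M_gt0 pdiv_dvd.
case lE : (logn p M) ME => [//|l] ME _.
have pl_gt1 : (1 < p ^ l.+1)%N by rewrite -{1}(expn0 p) ltn_exp2l // prime_gt1.
case: (ltngtP m 1) => [|m_gt1|m1].
- by case: m ME {pm} => // M0; rewrite M0 mul0n in M_gt0.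
- rewrite ME; apply: solvable_in_coprime => //.
  + by rewrite coprime_sym coprimeXl.
  + by apply: IH; rewrite // ME -{1}[m]muln1 ltn_pmul2l // ltnW.
  + exact: sol.
- by rewrite ME m1 mul1n; exact: sol.
Qed.

(** * Lifting solutions to the p-adic integers *)

Section Padic.
Variable p : nat.
Hypothesis p_pr : prime p.

Definition padic_component (n : nat) (a : 'Zp[p]) : 'Z_(p ^ n.+1) := padic_proj a n.

Fact padic_component_zmod n : zmod_morphism (padic_component n).
Proof. by []. Qed.

Fact padic_component_monoid n : monoid_morphism (padic_component n).
Proof. by []. Qed.

HB.instance Definition _ n := GRing.isZmodMorphism.Build 'Zp[p] 'Z_(p ^ n.+1)
  (padic_component n) (padic_component_zmod n).
HB.instance Definition _ n := GRing.isMonoidMorphism.Build 'Zp[p] 'Z_(p ^ n.+1)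
  (padic_component n) (padic_component_monoid n).

(** The inverses of [u] modulo the powers of [p] are compatible under reduction, hence define an
    element of the inverse limit. *)
Lemma padic_int_unit (u : int) : ~~ (p%:Z %| u)%Z -> (u%:~R : 'Zp[p]) \is a GRing.unit.
Proof.
move=> pu; have cE n : padic_proj (u%:~R : 'Zp[p]) n = u%:~R.
  exact: (rmorph_int (padic_component n)).
have uU n : (u%:~R : 'Z_(p ^ n.+1)) \is a GRing.unit.
  have N_gt1 : (1 < p ^ n.+1)%N by rewrite -{1}(expn0 p) ltn_exp2l // prime_gt1.
  case: u pu {cE} => k; rewrite dvdzE /= => pk.
    by rewrite -pmulrn unitZpE // coprimeXl // prime_coprime.
  by rewrite NegzE mulrNz unitrN -pmulrn unitZpE // coprimeXl // prime_coprime.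
have invP n : padic_red (u%:~R^-1 : 'Z_(p ^ n.+2)) = (u%:~R : 'Z_(p ^ n.+1))^-1.
  apply: (mulIr (uU n)); rewrite (mulVr (uU n)).
  transitivity (padic_red ((u%:~R)^-1 * u%:~R : 'Z_(p ^ n.+2))).
    rewrite [RHS]padic_redM; congr (_ * _).
    by rewrite -(cE n) -padicP cE.
  by rewrite (mulVr (uU n.+1)); exact: padic_red1.
apply/unitrP; exists (padic_of invP).
have inv1 : padic_of invP * u%:~R = 1.
  by apply: padic_ext => n /=; rewrite cE (mulVr (uU n)).
by split; rewrite // mulrC.
Qed.

Lemma solvable_in_padic P P' (u v w x y z : int) :
  (0 < cd P * lead_gcd P)%N -> ~~ (p%:Z %| u)%Z ->
  solution_mod P P' (p ^ logn p (cd P * lead_gcd P))%N u v w x y z ->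
  solvable_in 'Zp[p] P P'.
Proof.
move=> dg_gt0 pu; set g := lead_gcd P in dg_gt0 *.
have [c pc cE] := pfactor_coprime p_pr dg_gt0.
set q := (p ^ _)%N in cE *.
have cU : (c%:Z%:~R : 'Zp[p]) \is a GRing.unit.
  by apply: padic_int_unit; rewrite dvdzE /= -prime_coprime.
case=> /dvdzP[e4 E4] /dvdzP[e5 E5] /dvdzP[e2 E2].
(* The cofactor [c] of the [p]-part is a p-adic unit, so over the p-adic integers [q] is a multiple
   of [cd P * g]. *)
have qE : q%:R = (cd P)%:R * g%:R * c%:Z%:~R^-1 :> 'Zp[p].
  by apply: (mulIr cU); rewrite divrK // -pmulrn -!natrM cE mulnC.
have toR m n : m = n -> m%:~R = n%:~R :> 'Zp[p] by move->.
move: (toR _ _ E4) (toR _ _ E5) (toR _ _ E2).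
rewrite /defect124 /defect135 /defect125 -/g => {}E4 {}E5 {}E2.
pose i : 'Zp[p] := c%:Z%:~R^-1.
exists u%:~R; first exact: padic_int_unit.
(* The errors [e4 * q] and [e5 * q] have a factor [cd P] and are absorbed by [v] and [x]. This
   alters the third equation by multiples of [g], which the last witness compensates along with
   [e2 * q]. *)
exists (v%:~R + g%:R * i * e4%:~R), w%:~R, (x%:~R + g%:R * i * e5%:~R), y%:~R.
exists (z%:~R + (cd P)%:R * i * e2%:~R - i * ((ce P)%:R * e4%:~R + (cb P)%:R * e5%:~R
  + (cd P)%:R * (v%:~R * e5%:~R + x%:~R * e4%:~R + g%:R * i * e4%:~R * e5%:~R))).
have {}qE : q%:Z%:~R = (cd P)%:R * g%:R * i :> 'Zp[p] by rewrite -pmulrn.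
split.
- have -> : (cb P')%:R * u%:~R = (cb P)%:R - (ca P)%:R * w%:~R + (cd P)%:R * v%:~R
    + e4%:~R * q%:Z%:~R :> 'Zp[p] by rewrite -intrM -E4; ring.
  by rewrite qE; ring.
- have -> : (ce P')%:R * u%:~R = (ce P)%:R + (cf P)%:R * w%:~R + (cd P)%:R * x%:~R
    + (ch P)%:R * y%:~R + e5%:~R * q%:Z%:~R :> 'Zp[p] by rewrite -intrM -E5; ring.
  by rewrite qE; ring.
- have -> : (cc P')%:R * u%:~R ^+ 2 = (cc P)%:R + (ce P)%:R * v%:~R
    + (cb P)%:R * x%:~R + (cd P)%:R * v%:~R * x%:~R + g%:R * z%:~R
    + e2%:~R * q%:Z%:~R :> 'Zp[p] by rewrite -intrM -E2; ring.
  by rewrite qE; ring.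
Qed.

End Padic.

(** * The equivalence of the three conditions *)

Lemma T0_constants (t : Z5) : T0_2111 t -> exists2 P, constants_of t = P &
  [/\ [/\ Z5_entry t 1 2 3 = ca P, Z5_entry t 1 2 4 = cb P & Z5_entry t 1 2 5 = cc P],
      [/\ Z5_entry t 1 3 4 = cd P, Z5_entry t 1 3 5 = ce P, Z5_entry t 1 4 5 = cf P
        & Z5_entry t 2 3 5 = ch P] &
      [/\ (0 < ca P)%N, (0 < cd P)%N & (0 < cf P)%N]].
Proof.
case=> [[t123 t134 t145] [t124 t125 t135 t235] _ _ _].
exists (constants_of t) => //=; rewrite !absz_gt0 !lt0r_neq0 //.
by split=> //; split; rewrite gez0_abs // ltW.
Qed.

Lemma same_leading_constants (s t : Z5) : T0_2111 s -> T0_2111 t ->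
  same_leading s t <-> same_lead (constants_of s) (constants_of t).
Proof.
move=> /T0_constants[P -> [[Es1 _ _] [Es4 _ Es6 Es7] _]].
move=> /T0_constants[P' -> [[Et1 _ _] [Et4 _ Et6 Et7] _]].
rewrite /same_leading Es1 Es4 Es6 Es7 Et1 Et4 Et6 Et7.
split=> -[E1 E4 E6 E7]; last by rewrite E1 E4 E6 E7.
by case: E1 E4 E6 E7 => E1 [E4] [E6] [E7]; split.
Qed.

Lemma sim_constants (R : comUnitRingType) (s t : Z5) : T0_2111 s -> T0_2111 t ->
  sim R s t <-> same_lead (constants_of s) (constants_of t)
    /\ solvable_in R (constants_of s) (constants_of t).
Proof.
move=> sT tT; rewrite -same_leading_constants // /sim.
have [P -> [[Es1 Es2 Es3] [Es4 Es5 Es6 Es7] _]] := T0_constants sT.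
have [P' -> [[_ Et2 Et3] [_ Et5 _ _] _]] := T0_constants tT.
by rewrite /solvable_in /d3 Es1 Es2 Es3 Es4 Es5 Es6 Es7 Et2 Et3 Et5 -!pmulrn.
Qed.

Lemma local_cond_solution (s t : Z5) (p : nat) : T0_2111 s -> T0_2111 t ->
  let P := constants_of s in let P' := constants_of t in
  padic_local_cond s t p <-> exists u v w x y z : int, ~~ (p%:Z %| u)%Z /\
    solution_mod P P' (p ^ logn p (cd P * lead_gcd P))%N u v w x y z.
Proof.
move=> /T0_constants[P -> [[Es1 Es2 Es3] [Es4 Es5 Es6 Es7] _]].
move=> /T0_constants[P' -> [[Et1 Et2 Et3] [Et4 Et5 Et6 Et7] _]] /=.
rewrite /padic_local_cond /d3 Es1 Es2 Es3 Es4 Es5 Es6 Es7.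
rewrite Et2 Et3 Et5.
have dvdE q m n : (m = n %[mod q])%Z <-> (q %| m - n)%Z.
  by rewrite -eqz_mod_dvd; split=> [->|/eqP].
split=> -[u [v [w [x [y [z [pu [/dvdE E4 /dvdE E5 /dvdE E2]]]]]]]];
  exists u, v, w, x, y, z; split=> //; split=> //; exact/dvdE.
Qed.

Theorem theorem5 (T : set Z5) (hT : representatives T0_2111 (sim int) T)
    (s t : Z5) (hs : T s) (ht : T t) :
  [<-> finite_quotients (Gt s) = finite_quotients (Gt t);
       forall p : nat, prime p -> sim 'Zp[p] s t;
       same_leading s t /\ forall p : nat, prime p -> padic_local_cond s t p].
Proof.
have sT : T0_2111 s := hT.1 _ hs; have tT : T0_2111 t := hT.1 _ ht.
have [Ps PsE [_ _ [sa sd sf]]] := T0_constants sT.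
have [Pt PtE [_ _ [ta td tf]]] := T0_constants tT.
have simP R := sim_constants R sT tT; rewrite PsE PtE in simP.
have locP p := local_cond_solution p sT tT; rewrite PsE PtE /= in locP.
have FsP Q := finite_quotients_Gt Q sT; rewrite PsE in FsP.
have FtP Q := finite_quotients_Gt Q tT; rewrite PtE in FtP.
have dg_gt0 : (0 < cd Ps * lead_gcd Ps)%N by rewrite muln_gt0 sd !gcdn_gt0 sa.
set q := fun p => (p ^ logn p (cd Ps * lead_gcd Ps))%N in locP.
(* The exponent is one larger than required so that the modulus exceeds 1 even when the [p]-part is
   trivial; ['Z_1] is not the zero ring. *)
have weaken (p : nat) : prime p ->
    solvable_in 'Z_(p ^ (logn p (cd Ps * lead_gcd Ps)).+1) Ps Pt ->
    exists u v w x y z : int, ~~ (p%:Z %| u)%Z /\ solution_mod Ps Pt (q p) u v w x y z.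
  move=> p_pr /solvable_in_lift[|u [v [w [x [y [z [pu [E4 E5 E2]]]]]]]].
    by rewrite -{1}(expn0 p) ltn_exp2l // prime_gt1.
  exists u, v, w, x, y, z; split.
    by move: pu; rewrite coprimezE /= coprime_pexpl // prime_coprime.
  have qq : ((q p)%:Z %| (p ^ (logn p (cd Ps * lead_gcd Ps)).+1)%N%:Z)%Z.
    by rewrite dvdzE /= dvdn_exp2l.
  by split; exact: dvdz_trans qq _.
have of_padic P P' p n : prime p -> solvable_in 'Zp[p] P P' ->
    solvable_in 'Z_(p ^ n.+1) P P'.
  by move=> _; exact: (solvable_in_rmorph (@padic_component p n)).
have transport P P' Q : same_lead P P' ->
    (forall p, prime p -> solvable_in 'Zp[p] P P') -> is_quotient P Q -> is_quotient P' Q.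
  move=> PP' sol [g1 [g2 [g3 [g4 [g5 [gP gQ]]]]]].
  (* The factor 2 keeps the modulus above 1 when [Q] is trivial. *)
  have M_gt1 : (1 < #|Q| * 2)%N.
    by rewrite -cardsT leq_pmull // cardG_gt0.
  apply: (is_quotient_transport M_gt1 _ gP gQ PP'); first last.
    by apply: solvable_in_all => // p n p_pr; exact: of_padic (sol p p_pr).
  move=> x; have /dvdnP[k kE] := cardSg (finset.subsetT <[x]>%g).
  by rewrite -cardsT kE -mulnA mulnCA expgnA -orderE expg_order expg1n.
tfae.
- move=> Fst; have QE Q : is_quotient Ps Q <-> is_quotient Pt Q.
    by rewrite -FsP -FtP Fst.
  have st Q : is_quotient Ps Q -> is_quotient Pt Q by move/QE.
  have ts Q : is_quotient Pt Q -> is_quotient Ps Q by move/QE.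
  (* Each leading entry divides its counterpart in both directions. The order matters: the argument
     for [cd] and [ch] uses equality of [ca], that for [cf] also equality of [cd]. *)
  have Ea : ca Pt = ca Ps.
    by apply/eqP; rewrite eqn_dvd (ca_dvd sa sd ta td tf st) (ca_dvd ta td sa sd sf ts).
  have Ed : cd Pt = cd Ps.
    apply/eqP; rewrite eqn_dvd (cd_dvd sa sd ta td tf st Ea).
    by rewrite (cd_dvd ta td sa sd sf ts (esym Ea)).
  have Ef : cf Pt = cf Ps.
    apply/eqP; rewrite eqn_dvd (cf_dvd sa sd ta td tf st Ea Ed).
    by rewrite (cf_dvd ta td sa sd sf ts (esym Ea) (esym Ed)).
  have Eh : ch Pt = ch Ps.
    apply/eqP; rewrite eqn_dvd (ch_dvd sa sd ta td tf st Ea).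
    by rewrite (ch_dvd ta td sa sd sf ts (esym Ea)).
  move=> p p_pr; apply/simP; split; first by split.
  (* No limit of solutions is taken: a solution modulo the [p]-part of [cd Ps * lead_gcd Ps] already
     lifts. *)
  have [|u [v [w [x [y [z [pu S]]]]]]] := weaken p p_pr.
    exact: (solvable_prime_power sa sd sf ta td tf st Ea Ed Ef _ p_pr).
  exact: solvable_in_padic S.
- move=> sim_p; split; first by case: (sim_p 2 isT).
  move=> p p_pr; apply/locP; apply: weaken => //.
  by apply: of_padic => //; have /simP[] := sim_p p p_pr.
- move=> [lead loc]; have sol p : prime p -> solvable_in 'Zp[p] Ps Pt.
    by move=> p_pr; have /locP[u [v [w [x [y [z [pu S]]]]]]] := loc p p_pr;
       exact: solvable_in_padic S.
  have Pst : same_lead Ps Pt by rewrite -PsE -PtE -same_leading_constants.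
  have Pts : same_lead Pt Ps by case: Pst => *; split.
  apply/funext => Q; apply/propext; rewrite FsP FtP; split.
    exact: transport.
  by apply: transport => // p p_pr; apply: solvable_in_sym (sol p p_pr).
Qed.
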